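(* Let $t_1$ and $t_2$ be generalized taffy pulls. Then $t_1$ and $t_2$ are equivalent (that is, they have the same taffy diagram) if and only if they have the same taffy number, $Q(t_1)=Q(t_2)$.
   Context: **Generalized taffy pulls.** A generalized taffy pull is a finite (possibly empty) sequence $t=s_1s_2\cdots s_n$ of turns $s_i\in\{L,R,L^{-1},R^{-1}\}$ (left turn, right turn, reverse left turn, reverse right turn), performed from left to right. Adjacent pairs $LL^{-1},L^{-1}L,RR^{-1},R^{-1}R$ may be cancelled, so generalized taffy pulls may be regarded as elements of the free group on $L,R$. The empty sequence is denoted $t^0$ (the initial taffy pull). **Taffy diagrams.** A machine has three pegs, at the points $P=\{-1,0,1\}$ of the plane $\mathbb{C}$. The taffy is an arc: a simple (embedded) arc in $\mathbb{C}$ whose two distinct endpoints lie in $P$ and whose interior is disjoint from $P$ (the arc is unoriented, and pegs are distinguished only by position). Diagrams record the taffy with slack removed, where the taffy may neither cross itself nor pass through pegs; thus two arcs give the same diagram iff there is an ambient isotopy of $\mathbb{C}$ fixing $P$ pointwise that carries one to the other. A left turn $L$ exchanges the leftmost two pegs by rotating them counterclockwise by a half turn; a right turn $R$ exchanges the rightmost two pegs by rotating them clockwise by a half turn; $L^{-1},R^{-1}$ are the reverse motions. Concretely, let $\theta:[0,\infty)\to[0,\pi]$ be continuous with $\theta(r)=\pi$ for $r\le 0.6$, linear on $[0.6,0.9]$, and $\theta(r)=0$ for $r\ge 0.9$; then $L$ and $R$ act by the homeomorphisms $$h_L(z)=-\tfrac12+e^{i\theta(|z+1/2|)}\left(z+\tfrac12\right),\qquad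 h_R(z)=\tfrac12+e^{-i\theta(|z-1/2|)}\left(z-\tfrac12\right),$$ and $h_{L^{-1}}=h_L^{-1}$, $h_{R^{-1}}=h_R^{-1}$. The taffy initially is the straight segment $[-1,0]$. The diagram of $t=s_1\cdots s_n$ is the isotopy class of the arc $h_{s_n}\circ\cdots\circ h_{s_1}([-1,0])$. Two generalized taffy pulls are *equivalent* if they have the same diagram. **Taffy numbers.** The taffy number $Q(t)\in\mathbb{Q}\cup\{1/0\}$ of a generalized taffy pull $t=s_1\cdots s_n$ is obtained by starting with $0/1$ and applying successively, for $s_1,\dots,s_n$ in order, the rules $$L:\ \frac ab\mapsto\frac a{a+b},\qquad R:\ \frac ab\mapsto\frac{a+b}b,\qquad L^{-1}:\ \frac ab\mapsto\frac a{b-a},\qquad R^{-1}:\ \frac ab\mapsto\frac{a-b}b,$$ where fractions are elements of $\mathbb{Q}\cup\{1/0\}$, i.e. pairs $(a,b)\neq(0,0)$ of integers up to scaling (so $-1/0=1/0$). *)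

(* Defs.v *)
From HB Require Import structures.
From mathcomp Require Import all_boot all_order all_algebra.
From mathcomp Require Import all_classical all_reals all_analysis.
From mathcomp.real_closed Require Import complex.
From mathcomp Require Import zify.
Import numFieldNormedType.Exports Normc.
Import Order.TTheory GRing.Theory Num.Theory.

Set Implicit Arguments.
Unset Strict Implicit.
Unset Printing Implicit Defensive.

Local Open Scope classical_set_scope.
Local Open Scope complex_scope.
Local Open Scope ring_scope.

Inductive turn := LeftTurn | RightTurn | LeftTurnInv | RightTurnInv.

Definition taffy_pull := seq turn.

(* R[i] itself has no topology declared; its regular algebra R[i]^o has the *)
(* one given by the complex modulus.                                       *)
Notation plane R := (R[i]^o).

Section Diagrams.
Variable R : realType.

Definition pegs : set (plane R) := [set -1; 0; 1].

Definition is_arc (A : set (plane R)) : Prop :=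
  exists gamma : R -> plane R,
    [/\ {within `[0, 1], continuous gamma},
        {in `[0, 1]%classic &, injective gamma},
        A = gamma @` `[0, 1],
        pegs (gamma 0) /\ pegs (gamma 1)
      & forall t, t \in `]0, 1[ -> ~ pegs (gamma t)].

Definition homeomorphism (f : plane R -> plane R) : Prop :=
  exists g : plane R -> plane R,
    [/\ cancel f g, cancel g f, continuous f & continuous g].

Definition ambient_isotopy_rel_pegs (H : R * plane R -> plane R) : Prop :=
  [/\ {within `[0, 1] `*` setT, continuous H},
      forall t, t \in `[0, 1] -> homeomorphism (fun z => H (t, z)),
      forall z, H (0, z) = z
    & forall t p, t \in `[0, 1] -> pegs p -> H (t, p) = p].

Definition isotopic (A B : set (plane R)) : Prop :=
  exists H, ambient_isotopy_rel_pegs H /\ (fun z => H (1, z)) @` A = B.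

Definition theta (r : R) : R :=
  if r <= 6 / 10 then pi
  else if r <= 9 / 10 then pi * ((9 / 10 - r) / (3 / 10))
  else 0.

Definition expi (t : R) : R[i] := cos t +i* sin t.

Definition twist (c s : R) (z : plane R) : plane R :=
  c%:C + expi (s * theta (normc (z - c%:C))) * (z - c%:C).

Definition turn_map (s : turn) : plane R -> plane R :=
  match s with
  | LeftTurn => twist (- 2^-1) 1
  | RightTurn => twist 2^-1 (-1)
  | LeftTurnInv => twist (- 2^-1) (-1)
  | RightTurnInv => twist 2^-1 1
  end.

Definition pull_map (t : taffy_pull) : plane R -> plane R :=
  foldl (fun f s => turn_map s \o f) id t.

Definition initial_arc : set (plane R) := [set x%:C | x in `[-1, 0]].

Definition taffy_arc (t : taffy_pull) : set (plane R) :=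
  pull_map t @` initial_arc.

Definition diagram (t : taffy_pull) : set (set (plane R)) :=
  [set B | is_arc B /\ isotopic (taffy_arc t) B].

Definition equivalent (t1 t2 : taffy_pull) : Prop := diagram t1 = diagram t2.

Lemma expiD (a b : R) : expi (a + b) = expi a * expi b.
Proof.
by rewrite /expi cosD sinD; simpc; rewrite [sin a * _ + _]addrC.
Qed.

Lemma normc_expi (a : R) : normc (expi a) = 1.
Proof. by rewrite /expi /= cos2Dsin2 sqrtr1. Qed.

(* Hence the maps given to LeftTurnInv and RightTurnInv are the inverses of *)
(* those given to LeftTurn and RightTurn.                                   *)
Lemma twistK (c s : R) : cancel (twist c s) (twist c (- s)).
Proof.
move=> z; rewrite {1}/twist.
have -> : twist c s z - c%:C =
    expi (s * theta (normc (z - c%:C))) * (z - c%:C).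
  by rewrite /twist addrAC subrr add0r.
rewrite normcM normc_expi mul1r mulrA -expiD mulNr addNr.
have -> : expi 0 = 1 by rewrite /expi cos0 sin0.
by rewrite mul1r addrC subrK.
Qed.

End Diagrams.

(* Q together with 1/0, the latter being None. By frac_eqP this is the set of *)
(* pairs (a, b) != (0, 0) up to scaling, and by turn_fracE the rules do not   *)
(* depend on the pair representing a fraction.                                *)
Definition fraction := option rat.

Definition frac (ab : int * int) : fraction :=
  if ab.2 == 0 then None else Some (ab.1%:~R / ab.2%:~R).

Definition repr_frac (x : fraction) : int * int :=
  if x is Some q then (numq q, denq q) else (1, 0).

Definition turn_rule (s : turn) (ab : int * int) : int * int :=
  let: (a, b) := ab in
  match s with
  | LeftTurn => (a, a + b)
  | RightTurn => (a + b, b)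
  | LeftTurnInv => (a, b - a)
  | RightTurnInv => (a - b, b)
  end.

Definition turn_frac (s : turn) (x : fraction) : fraction :=
  frac (turn_rule s (repr_frac x)).

Definition taffy_number (t : taffy_pull) : fraction :=
  foldl (fun x s => turn_frac s x) (frac (0, 1)) t.

Lemma repr_fracK : cancel repr_frac frac.
Proof. by case=> [q|] //; rewrite /frac /= (negbTE (denq_neq0 q)) divq_num_den. Qed.

Lemma repr_frac_neq0 (x : fraction) : repr_frac x != (0, 0).
Proof. by case: x => [q|] //=; rewrite xpair_eqE negb_and denq_neq0 orbT. Qed.

Lemma frac_eqP (a b c d : int) : (a, b) != (0, 0) -> (c, d) != (0, 0) ->
  frac (a, b) = frac (c, d) <-> a * d = b * c.
Proof.
rewrite !xpair_eqE /frac /= => ab0 cd0.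
have [b0|b0] := eqVneq b 0; have [d0|d0] := eqVneq d 0.
- by split=> // _; rewrite b0 d0 mulr0 mul0r.
- split=> // /eqP; rewrite b0 mul0r mulf_eq0 (negbTE d0) orbF => /eqP a0.
  by move: ab0; rewrite a0 b0.
- split=> // /esym/eqP; rewrite d0 mulr0 mulf_eq0 (negbTE b0) /= => /eqP c0.
  by move: cd0; rewrite c0 d0.
- split=> [[/eqP]|e].
    by rewrite eqr_div ?intr_eq0 // -!intrM eqr_int [c * b]mulrC => /eqP.
  congr Some; apply/eqP.
  by rewrite eqr_div ?intr_eq0 // -!intrM eqr_int [c * b]mulrC e.
Qed.

Lemma turn_rule_neq0 (s : turn) (ab : int * int) :
  ab != (0, 0) -> turn_rule s ab != (0, 0).
Proof.
case: ab => a b; apply: contraNneq.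
by case: s => /= -[] e1 e2; apply/eqP; congr pair; lia.
Qed.

Lemma turn_fracE (s : turn) (ab : int * int) : ab != (0, 0) ->
  turn_frac s (frac ab) = frac (turn_rule s ab).
Proof.
move=> ab0; have := repr_fracK (frac ab); have := repr_frac_neq0 (frac ab).
rewrite /turn_frac; case: (repr_frac _) => c d; case: ab ab0 => a b ab0 cd0.
move=> /(frac_eqP cd0 ab0) e.
have := turn_rule_neq0 s cd0; have := turn_rule_neq0 s ab0.
by case: s => /= n0 n1; apply/frac_eqP => //; lia.
Qed.

(* Main.v *)
(* Call [rho] the half turn z |-> -z, and attach to a pull the integer vector
   (a, b) computed by the rules without reduction.

   Equal numbers give isotopic arcs.  The turn [L] preserves the initial arc
   setwise, [rho] conjugates [L] to [R^-1], and [L R^-1 L] is isotopic to [rho]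
   relative to the pegs: after an affine normalization of the two outer pegs, the
   third peg describes a loop in the upper half plane, which can be undone by
   pushing the plane along it.  These relations rewrite every pull into a positive
   word in [L] and [R], possibly followed by [rho]; if a = 0 that word is a power
   of [L], and its arc is the initial one.

   Isotopic arcs have equal numbers.  The plane is the quotient of R^2 minus
   (2 pi Z)^2 by x |-> -x and 2 pi Z^2, the pegs being the other half periods.
   It suffices to know the functions cos x, cos y and sin x sin y on the plane.
   The initial arc lifts to the segment from (pi, 0) to (pi, pi), and [L], [R] act
   on lifts by shears up to homotopy, so the endpoints of a lift of the arc of a
   pull differ by pi (a, b).  Lifting an isotopy that ends at the initial arc,
   where x = pi is constant, gives a = 0. *)

Require Import Defs.
From mathcomp Require Import all_boot all_order all_algebra.
From mathcomp Require Import all_classical all_reals all_analysis.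
From mathcomp.real_closed Require Import complex.
From mathcomp Require Import zify ring lra.
Import numFieldNormedType.Exports Normc.
Import Order.TTheory GRing.Theory Num.Theory.

Set Implicit Arguments.
Unset Strict Implicit.
Unset Printing Implicit Defensive.

Local Open Scope classical_set_scope.
Local Open Scope complex_scope.
Local Open Scope ring_scope.

Local Notation Re := (@complex.Re _).
Local Notation Im := (@complex.Im _).

(** * Continuity in the plane and isotopies *)

Section Topology.
Variable R : realType.

(** Undoing [t2] after [t1] reduces both implications to comparing one arc with the initial one;
    since the rules have determinant 1, equality of the numbers becomes a = 0.

    The map to the quotient is not shown to be a homeomorphism. It is given by explicit functions X
    = [cosx], Y = [cosy], F = [sinxy] with F^2 = (1 - X^2) (1 - Y^2), and what matters is that X^2 =
    Y^2 = 1 holds at the pegs only.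

    The obstacle to lifting is that R^2 branches over the pegs, exactly where the arcs end. The arcs
    are therefore cut off near both ends. On the compact remainder 2 - X^2 - Y^2 is bounded below,
    and a lift is carried along in finitely many small time steps. The removed ends are controlled
    by an estimate alone: near a peg cos^2 x > 1/2, so x stays within pi/4 of the same multiple of
    pi. The resulting bound |a| pi < pi suffices because a is an integer. *)

Lemma plane_eq (z w : plane R) : Re z = Re w -> Im z = Im w -> z = w.
Proof. by case: z w => a b [c d] /= -> ->. Qed.

Lemma normr_Re_le (z : R[i]) : (`|Re z| <= normc z)%R.
Proof.
case: z => a b /=; rewrite -sqrtr_sqr ler_wsqrtr //.
by rewrite lerDl sqr_ge0.
Qed.

Lemma normr_Im_le (z : R[i]) : (`|Im z| <= normc z)%R.
Proof.
case: z => a b /=; rewrite -sqrtr_sqr ler_wsqrtr //.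
by rewrite lerDr sqr_ge0.
Qed.

Lemma normc_le_ReIm (z : R[i]) : (normc z <= `|Re z| + `|Im z|)%R.
Proof.
case: z => a b /=; rewrite -[leRHS]ger0_norm ?addr_ge0 // -sqrtr_sqr ler_wsqrtr //.
by rewrite sqrrD !real_normK ?num_real // -addrA lerD2l lerDr mulrn_wge0 // mulr_ge0.
Qed.

Lemma normCE (z : R[i]) : `|z| = (normc z)%:C.
Proof. by case: z. Qed.

Lemma cvg_planeP (T : Type) (F : set_system T) (FF : Filter F)
    (f : T -> plane R) (l : plane R) :
  f @ F --> l <->
  (Re (f x) @[x --> F] --> Re l) /\ (Im (f x) @[x --> F] --> Im l).
Proof.
split=> [fl|[fRe fIm]].
  split; apply/cvgrPdist_lt => e e0.
    have /cvgrPdist_lt/(_ e%:C) := fl; rewrite ltcR => /(_ e0).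
    apply: filterS => t; rewrite normCE ltcR; apply: le_lt_trans.
    by rewrite (le_trans _ (normr_Re_le _)) // raddfB.
  have /cvgrPdist_lt/(_ e%:C) := fl; rewrite ltcR => /(_ e0).
  apply: filterS => t; rewrite normCE ltcR; apply: le_lt_trans.
  by rewrite (le_trans _ (normr_Im_le _)) // raddfB.
apply/cvgrPdist_lt => -[e e'] /=; rewrite ltcE /= => /andP[/eqP -> e0].
have e20 : 0 < e / 2 by rewrite divr_gt0.
move/cvgrPdist_lt/(_ _ e20) : fRe => fRe.
move/cvgrPdist_lt/(_ _ e20) : fIm => fIm.
apply: filterS2 fRe fIm => t tRe tIm.
rewrite normCE ltcR (le_lt_trans (normc_le_ReIm _)) // [ltRHS]splitr.
by rewrite ltrD // raddfB.
Qed.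

Lemma cont_pair (T U V : topologicalType) (f : T -> U) (g : T -> V) :
  continuous f -> continuous g -> continuous (fun t => (f t, g t)).
Proof.
move=> cf cg t.
exact: (@cvg_pair T U V (nbhs t) (nbhs (f t)) (nbhs (g t)) _ _ _ f g (cf t) (cg t)).
Qed.

Lemma cont_fun_comp (T U V : topologicalType) (h : U -> V) (f : T -> U) :
  continuous h -> continuous f -> continuous (fun t => h (f t)).
Proof. by move=> ch cf t; apply: continuous_comp; [exact: cf|exact: ch]. Qed.

Lemma cont_id (T : topologicalType) : continuous (@id T).
Proof. by move=> t; exact: cvg_id. Qed.

Lemma cont_fst (T U : topologicalType) : continuous (@fst T U).
Proof. by move=> t; exact: cvg_fst. Qed.

Lemma cont_snd (T U : topologicalType) : continuous (@snd T U).
Proof. by move=> t; exact: cvg_snd. Qed.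

Lemma cont_within_comp (T U V : topologicalType) (A : set U) (h : U -> V) (f : T -> U) :
  {within A, continuous h} -> continuous f -> (forall t, A (f t)) ->
  continuous (fun t => h (f t)).
Proof.
move=> /subspace_continuousP hc fc Af t W hW.
have ft := fc t _ (hc _ (Af t) _ hW).
change (nbhs t (fun u => W (h (f u)))).
change (nbhs t (fun u => A (f u) -> W (h (f u)))) in ft.
by apply: filterS ft => u; apply; exact: Af.
Qed.

Section RealContinuity.
Variable T : topologicalType.
Implicit Types f g : T -> R.

Lemma cont_add f g : continuous f -> continuous g -> continuous (fun t => f t + g t).
Proof. by move=> cf cg t; apply: cvgD; [exact: cf|exact: cg]. Qed.

Lemma cont_opp f : continuous f -> continuous (fun t => - f t).
Proof. by move=> cf t; apply: cvgN; exact: cf. Qed.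

Lemma cont_mul f g : continuous f -> continuous g -> continuous (fun t => f t * g t).
Proof. by move=> cf cg t; apply: cvgM; [exact: cf|exact: cg]. Qed.

Lemma cont_inv f :
  continuous f -> (forall t, f t != 0) -> continuous (fun t => (f t)^-1).
Proof. by move=> cf f0 t; apply: cvgV; [exact: f0|exact: cf]. Qed.

Lemma cont_max f g :
  continuous f -> continuous g -> continuous (fun t => Num.max (f t) (g t)).
Proof. by move=> cf cg t; apply: continuous_max; [exact: cf|exact: cg]. Qed.

Lemma cont_min f g :
  continuous f -> continuous g -> continuous (fun t => Num.min (f t) (g t)).
Proof. by move=> cf cg t; apply: continuous_min; [exact: cf|exact: cg]. Qed.

Lemma cont_cst (a : R) : continuous (fun _ : T => a).
Proof. by move=> t; exact: cvg_cst. Qed.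

Lemma cont_exp f n : continuous f -> continuous (fun t => f t ^+ n).
Proof.
move=> cf; elim: n => [|n IH]; first exact: cont_cst.
rewrite (_ : (fun t => _) = fun t => f t * f t ^+ n); first exact: cont_mul.
by apply/funext => t; rewrite exprS.
Qed.

End RealContinuity.

(* The sign may jump only where [g] vanishes. *)
Lemma cont_sg (T : topologicalType) (f g : T -> R) :
  continuous f -> continuous g -> (forall t, f t = 0 -> g t = 0) ->
  continuous (fun t => Num.sg (f t) * g t).
Proof.
move=> fc gc fg t.
rewrite /continuous_at /=; have [f0|f0|f0] := ltrgt0P (f t).
- rewrite gtr0_sg // mul1r; apply: cvg_trans (gc t); apply: near_eq_cvg.
  have nf : nbhs t (fun u => 0 < f u) := fc t _ (lt_nbhsr f0).
  apply: filterS nf => u fu.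
  by rewrite gtr0_sg // mul1r.
- rewrite ltr0_sg // mulN1r; apply: cvg_trans (cvgN (gc t)); apply: near_eq_cvg.
  have nf : nbhs t (fun u => f u < 0) := fc t _ (lt_nbhsl f0).
  apply: filterS nf => u fu.
  by rewrite ltr0_sg // mulN1r.
- rewrite f0 sgr0 mul0r; apply/cvgrPdist_lt => e e0.
  have /cvgrPdist_lt/(_ e e0) := gc t; rewrite (fg t f0).
  apply: filterS => u; rewrite !sub0r !normrN normrM; apply: le_lt_trans.
  by rewrite ler_piMl // normr_sg lern1; case: (_ == _).
Qed.

Section PlaneContinuity.
Variable T : topologicalType.
Implicit Types f g : T -> plane R.

Lemma continuous_planeP f :
  continuous f <->
  continuous (fun t => Re (f t)) /\ continuous (fun t => Im (f t)).
Proof.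
split=> [fc|[cRe cIm] t]; last by apply/cvg_planeP; split; [exact: cRe|exact: cIm].
by split=> t; have /cvg_planeP[] := fc t.
Qed.

Lemma continuous_plane (a b : T -> R) :
  continuous a -> continuous b -> continuous (fun t => a t +i* b t : plane R).
Proof. by move=> ca cb; apply/continuous_planeP. Qed.

Lemma continuous_planeD f g :
  continuous f -> continuous g -> continuous (fun t => f t + g t).
Proof. by move=> cf cg t; apply: cvgD; [exact: cf|exact: cg]. Qed.

Lemma continuous_planeM f g :
  continuous f -> continuous g -> continuous (fun t => f t * g t).
Proof.
move=> /continuous_planeP[fR fI] /continuous_planeP[gR gI].
have -> : (fun t => f t * g t) = (fun t =>
    (Re (f t) * Re (g t) - Im (f t) * Im (g t)) +i*
    (Re (f t) * Im (g t) + Im (f t) * Re (g t))).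
  by apply/funext => t; case: (f t) (g t) => a b [c d].
apply: continuous_plane => t.
  by apply: cvgB; apply: cvgM; [exact: fR|exact: gR|exact: fI|exact: gI].
by apply: cvgD; apply: cvgM; [exact: fR|exact: gI|exact: fI|exact: gR].
Qed.

Lemma continuous_planeV f :
  continuous f -> (forall t, f t != 0) -> continuous (fun t => (f t)^-1).
Proof.
move=> /continuous_planeP[fR fI] f0.
have -> : (fun t => (f t)^-1) = (fun t =>
    (Re (f t) / (Re (f t) ^+ 2 + Im (f t) ^+ 2)) +i*
    (- Im (f t) / (Re (f t) ^+ 2 + Im (f t) ^+ 2))).
  by apply/funext => t; case: (f t) => a b; rewrite mulNr.
have n0 t : Re (f t) ^+ 2 + Im (f t) ^+ 2 != 0.
  have := f0 t; case: (f t) => a b /=; apply: contraNneq => /eqP.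
  by rewrite paddr_eq0 ?sqr_ge0 // !sqrf_eq0 => /andP[/eqP-> /eqP->].
have cV : continuous (fun t => (Re (f t) ^+ 2 + Im (f t) ^+ 2)^-1).
  move=> t; apply: cvgV => //; apply: cvgD; rewrite ?expr2.
    by apply: cvgM; exact: fR.
  by apply: cvgM; exact: fI.
apply: continuous_plane => t; apply: cvgM; try exact: cV; first exact: fR.
by apply: cvgN; exact: fI.
Qed.

End PlaneContinuity.

Definition isotopy_rel_pegs (H : R * plane R -> plane R) : Prop :=
  [/\ continuous H, forall t, homeomorphism (fun z => H (t, z)),
      forall z, H (0, z) = z & forall t p, pegs p -> H (t, p) = p].

Definition clamp (t : R) : R := Num.max 0 (Num.min 1 t).

Lemma clampP t : 0 <= clamp t <= 1.
Proof.
rewrite /clamp /Num.max /Num.min.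
by case: (ltP 1 t) => h1; case: ltP => h2; lra.
Qed.

Lemma clamp_id t : 0 <= t <= 1 -> clamp t = t.
Proof.
rewrite /clamp /Num.max /Num.min => /andP[t0 t1].
case: (ltP 1 t) => h1; case: ltP => h2 //; lra.
Qed.

Lemma continuous_clamp : continuous clamp.
Proof.
apply: cont_max; first exact: cont_cst.
by apply: cont_min; [exact: cont_cst|move=> t; exact: cvg_id].
Qed.

(** Clamping the time to [0, 1] extends an isotopy to the whole real line, so that it can be
    composed with globally continuous maps. *)
Lemma isotopicP (A B : set (plane R)) :
  isotopic A B <->
  exists H, isotopy_rel_pegs H /\ (fun z => H (1, z)) @` A = B.
Proof.
split=> -[H [[Hc Hh H0 Hp] <-]]; last first.
  exists H; split=> //; split=> //; last by move=> t p _; exact: Hp.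
  exact: continuous_subspaceT.
exists (fun tz => H (clamp tz.1, tz.2)); split; last first.
  by rewrite /= clamp_id // lexx ler01.
have cI t : clamp t \in `[0, 1] by rewrite in_itv; exact: clampP.
split=> /= [|t|z|t p pp]; last 3 first.
- exact: Hh.
- by rewrite clamp_id ?H0 // lexx ler01.
- exact: Hp.
apply: (cont_within_comp Hc) => [|t]; last by split=> //; exact: cI.
apply: cont_pair; last exact: cont_snd.
exact: (cont_fun_comp continuous_clamp (@cont_fst _ _)).
Qed.

Lemma homeomorphism_comp (f g : plane R -> plane R) :
  homeomorphism f -> homeomorphism g -> homeomorphism (f \o g).
Proof.
move=> [f' [fK f'K fc f'c]] [g' [gK g'K gc g'c]]; exists (g' \o f'); split.
- exact: can_comp.
- exact: can_comp.
- by move=> z; apply: continuous_comp; [exact: gc|exact: fc].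
- by move=> z; apply: continuous_comp; [exact: f'c|exact: g'c].
Qed.

Lemma homeomorphism_id : homeomorphism (@id (plane R)).
Proof. by exists id; split=> // z; exact: cvg_id. Qed.

Lemma isotopy_id : isotopy_rel_pegs snd.
Proof. by split=> // [p|t]; [exact: cvg_snd|exact: homeomorphism_id]. Qed.

Lemma isotopy_comp (H K : R * plane R -> plane R) :
  isotopy_rel_pegs H -> isotopy_rel_pegs K ->
  isotopy_rel_pegs (fun tz => K (tz.1, H tz)).
Proof.
move=> [Hc Hh H0 Hp] [Kc Kh K0 Kp]; split=> [|t|z|t p pp] /=.
- exact: (cont_fun_comp Kc (cont_pair (@cont_fst _ _) Hc)).
- exact: (@homeomorphism_comp (fun z => K (t, z)) (fun z => H (t, z))).
- by rewrite H0 K0.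
- by rewrite Hp ?Kp.
Qed.

Lemma isotopic_refl (A : set (plane R)) : isotopic A A.
Proof.
by apply/isotopicP; exists snd; split; [exact: isotopy_id|rewrite image_id].
Qed.

Lemma isotopic_trans (B A C : set (plane R)) :
  isotopic A B -> isotopic B C -> isotopic A C.
Proof.
move=> /isotopicP[H [Hi <-]] /isotopicP[K [Ki <-]]; apply/isotopicP.
exists (fun tz => K (tz.1, H tz)); split; first exact: isotopy_comp.
by rewrite image_comp.
Qed.

(** The reversed isotopy is H_(1-t) composed with the inverse of H_1: a single inverse map enters,
    so continuity in time is inherited from H. *)
Lemma isotopic_sym (A B : set (plane R)) : isotopic A B -> isotopic B A.
Proof.
move=> /isotopicP[H [[Hc Hh H0 Hp] <-]]; apply/isotopicP.
have [g [gK Kg H1c gc]] := Hh 1.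
exists (fun tz => H (1 - tz.1, g tz.2)); split; last first.
  rewrite image_comp -[RHS]image_id; apply: eq_imagel => z _ /=.
  by rewrite subrr H0 gK.
split=> [|t|z|t p pp] /=.
- apply: (cont_fun_comp Hc); apply: cont_pair.
    by move=> tz; apply: cvgB; [exact: cvg_cst|exact: cvg_fst].
  exact: (cont_fun_comp gc (@cont_snd _ _)).
- apply: (@homeomorphism_comp (fun z => H (1 - t, z)) g); first exact: Hh.
  by exists (fun z => H (1, z)); split; [exact: Kg|exact: gK|exact: gc|exact: H1c].
- by rewrite subr0 Kg.
- by rewrite (_ : g p = p) ?Hp // -[in LHS](Hp 1 p pp) gK.
Qed.

Lemma isotopic_image (f : plane R -> plane R) (A B : set (plane R)) :
  homeomorphism f -> (forall p, pegs (f p) -> pegs p) ->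
  isotopic A B -> isotopic (f @` A) (f @` B).
Proof.
move=> fh; have [g [fK gK fc gc]] := fh.
move=> fp /isotopicP[H [[Hc Hh H0 Hp] <-]]; apply/isotopicP.
exists (fun tz => f (H (tz.1, g tz.2))); split; last first.
  by rewrite !image_comp; apply: eq_imagel => z _ /=; rewrite fK.
split=> [|t|z|t p pp] /=.
- apply: (cont_fun_comp fc); apply: (cont_fun_comp Hc).
  by apply: cont_pair; [exact: cont_fst|exact: (cont_fun_comp gc (@cont_snd _ _))].
- apply: (@homeomorphism_comp f (H \o pair t \o g) fh).
  apply: (@homeomorphism_comp (fun z => H (t, z)) g); first exact: Hh.
  by exists f; split; [exact: gK|exact: fK|exact: gc|exact: fc].
- by rewrite H0 gK.
- by rewrite Hp ?gK //; apply: fp; rewrite gK.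
Qed.

End Topology.

(** * The turns *)

Section Turns.
Variable R : realType.

Lemma theta_inner (r : R) : r <= 6 / 10 -> theta r = pi.
Proof. by rewrite /theta => ->. Qed.

Lemma theta_outer (r : R) : 9 / 10 <= r -> theta r = 0.
Proof.
rewrite /theta => r9; rewrite ifF; last by apply/negbTE; rewrite -ltNge; lra.
case: ifP => // r9'; rewrite (_ : r = 9 / 10) ?subrr ?mul0r ?mulr0 //; lra.
Qed.

(** One formula for the three pieces, from which continuity follows without gluing. *)
Lemma theta_clamp (r : R) : theta r = pi * clamp ((9 / 10 - r) / (3 / 10)).
Proof.
rewrite /theta /clamp /Num.max /Num.min.
case: ifPn => [r6|]; [|rewrite -ltNge => r6; case: ifPn => [r9|]].
- case: (ltP 1) => h; first by rewrite ltr01 mulr1.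
  rewrite (_ : (9 / 10 - r) / (3 / 10) = 1) ?ltr01 ?mulr1 //; lra.
- case: (ltP 1) => h; first by lra.
  by case: ltP => h2 //; congr (_ * _); lra.
- rewrite -ltNge => r9; case: (ltP 1) => h; first by lra.
  by case: ltP => h2; [lra|rewrite mulr0].
Qed.

Lemma continuous_theta : continuous (@theta R).
Proof.
rewrite (_ : @theta R = fun r => pi * clamp ((9 / 10 - r) / (3 / 10))); last first.
  by apply/funext => r; exact: theta_clamp.
apply: cont_mul; first exact: cont_cst.
apply: (cont_fun_comp (@continuous_clamp R)).
apply: cont_mul; last exact: cont_cst.
apply: cont_add; first exact: cont_cst.
by apply: cont_opp => r; exact: cvg_id.
Qed.

Lemma cont_normc (T : topologicalType) (f : T -> plane R) :
  continuous f -> continuous (fun t => normc (f t)).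
Proof.
move=> /continuous_planeP[fR fI].
rewrite (_ : (fun t => _) = fun t => Num.sqrt (Re (f t) ^+ 2 + Im (f t) ^+ 2)).
  apply: (cont_fun_comp (@sqrt_continuous R)).
  by apply: cont_add; exact: cont_exp.
by apply/funext => t; case: (f t).
Qed.

Lemma cont_expi (T : topologicalType) (f : T -> R) :
  continuous f -> continuous (fun t => expi (f t) : plane R).
Proof.
move=> cf; apply: continuous_plane.
  exact: (cont_fun_comp (@continuous_cos R)).
exact: (cont_fun_comp (@continuous_sin R)).
Qed.

Lemma cont_plane_cst (T : topologicalType) (z : plane R) : continuous (fun _ : T => z).
Proof. by move=> t; exact: cvg_cst. Qed.

Lemma cont_twist (T : topologicalType) (c : R) (s : T -> R) (f : T -> plane R) :
  continuous s -> continuous f -> continuous (fun t => twist c (s t) (f t)).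
Proof.
move=> cs cf.
have cfc : continuous (fun t => f t - c%:C).
  exact: (continuous_planeD cf (@cont_plane_cst T (- c%:C))).
apply: (continuous_planeD (@cont_plane_cst T c%:C)).
apply: (continuous_planeM _ cfc); apply: cont_expi; apply: (cont_mul cs).
exact: (cont_fun_comp continuous_theta (cont_normc cfc)).
Qed.

Lemma twist_homeomorphism (c s : R) : homeomorphism (twist c s).
Proof.
have tc u : continuous (twist c u).
  exact: (@cont_twist _ c (fun _ => u) id (@cont_cst R _ u) (@cont_id _)).
exists (twist c (- s)); split=> //; first exact: twistK.
by rewrite -{2}[s]opprK; exact: twistK.
Qed.

Lemma twistN (c s : R) (z : plane R) : twist (- c) s (- z) = - twist c s z.
Proof.
rewrite /twist (_ : (- c)%:C = - c%:C); last by rewrite rmorphN.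
by rewrite -opprD normcN mulrN opprD.
Qed.

Lemma twist_inner (c s : R) (z : plane R) : normc (z - c%:C) <= 6 / 10 ->
  twist c s z = c%:C + expi (s * pi) * (z - c%:C).
Proof. by rewrite /twist => /theta_inner ->. Qed.

Lemma twist_outer (c s : R) (z : plane R) : 9 / 10 <= normc (z - c%:C) ->
  twist c s z = z.
Proof.
rewrite /twist => /theta_outer ->; rewrite mulr0 /expi cos0 sin0.
by rewrite (_ : 1 +i* 0 = 1) // mul1r addrC subrK.
Qed.

Lemma normc_real (x : R) : normc x%:C = `|x|.
Proof. by rewrite /= expr0n addr0 sqrtr_sqr. Qed.

Lemma twist_half (c s : R) (z : plane R) : s = 1 \/ s = -1 ->
  normc (z - c%:C) <= 6 / 10 -> twist c s z = (2 * c)%:C - z.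
Proof.
move=> s1 /twist_inner ->; have -> : expi (s * pi) = -1.
  case: s1 => ->; rewrite /expi ?mulN1r ?cosN ?sinN ?mul1r cospi sinpi ?oppr0 //.
    by apply: plane_eq; rewrite /= ?oppr0.
  by apply: plane_eq; rewrite /= ?oppr0.
by rewrite mulN1r opprB addrA -rmorphD mulr_natl mulr2n.
Qed.

Definition turn_center (s : turn) : R :=
  match s with LeftTurn | LeftTurnInv => - 2^-1 | _ => 2^-1 end.
Definition turn_sign (s : turn) : R :=
  match s with LeftTurn | RightTurnInv => 1 | _ => -1 end.

Lemma turn_mapE s : turn_map s = twist (turn_center s) (turn_sign s).
Proof. by case: s. Qed.

Lemma turn_sign1 s : turn_sign s = 1 \/ turn_sign s = -1.
Proof. by case: s; [left|right|right|left]. Qed.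

Definition turn_inv (s : turn) : turn :=
  match s with
  | LeftTurn => LeftTurnInv | RightTurn => RightTurnInv
  | LeftTurnInv => LeftTurn | RightTurnInv => RightTurn
  end.

(** Conjugation by z |-> -z, which exchanges the two centers and keeps the sense of rotation. *)
Definition turn_flip (s : turn) : turn :=
  match s with
  | LeftTurn => RightTurnInv | RightTurn => LeftTurnInv
  | LeftTurnInv => RightTurn | RightTurnInv => LeftTurn
  end.

Lemma turn_mapK s : cancel (@turn_map R s) (turn_map (turn_inv s)).
Proof.
have K c : cancel (twist c (-1)) (twist c (1 : R)).
  by have := @twistK R c (-1); rewrite opprK.
by case: s => /=; [exact: twistK|exact: K|exact: K|exact: twistK].
Qed.

Lemma turn_map_flip s (z : plane R) : turn_map (turn_flip s) (- z) = - turn_map s z.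
Proof.
by case: s => /=; rewrite -twistN ?opprK.
Qed.

Lemma turn_homeomorphism s : homeomorphism (@turn_map R s).
Proof. by rewrite turn_mapE; exact: twist_homeomorphism. Qed.

Lemma twist_peg (c s x : R) : c = 2^-1 \/ c = - 2^-1 -> s = 1 \/ s = -1 ->
  x = -1 \/ x = 0 \/ x = 1 ->
  twist c s x%:C = (if x == - 2 * c then x else 2 * c - x)%:C.
Proof.
move=> c2 s1 x3; case: ifPn => [/eqP xc|xc].
  apply: twist_outer; rewrite -rmorphB normc_real xc; case: c2 => ->.
    by rewrite ler0_norm; lra.
  by rewrite ger0_norm; lra.
rewrite twist_half ?rmorphB // -rmorphB normc_real ler_norml.
by move: x3 xc; case: c2 => -> [|[|]] -> /eqP; lra.
Qed.

Lemma pegsP (p : plane R) :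
  pegs p <-> exists2 x : R, x = -1 \/ x = 0 \/ x = 1 & p = x%:C.
Proof.
rewrite /pegs /=; split=> [[[]|] ->|[x [|[|]] -> ->]].
- by exists (-1); [left|rewrite rmorphN1].
- by exists 0; [right; left|].
- by exists 1; [right; right|].
- by left; left; rewrite rmorphN1.
- by left; right.
- by right.
Qed.

Lemma turn_pegs s (p : plane R) : pegs p -> pegs (turn_map s p).
Proof.
move=> /pegsP[x x3 ->]; apply/pegsP; rewrite turn_mapE twist_peg //; last first.
- exact: turn_sign1.
- by case: s; rewrite /=; [right|left|right|left].
eexists; last by [].
case: ifPn x3 => // /eqP; case: s => /= n [|[|]] e; move: n; rewrite e => n;
  by [left; lra|right; left; lra|right; right; lra|case: n; lra].
Qed.

Lemma turn_pegs_inv s (p : plane R) : pegs (turn_map s p) -> pegs p.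
Proof. by move=> /(turn_pegs (turn_inv s)); rewrite turn_mapK. Qed.

Lemma opp_pegs (p : plane R) : pegs (- p) -> pegs p.
Proof.
move=> /pegsP[x x3 e]; apply/pegsP; exists (- x).
  by case: x3 => [|[|]] ->; [right; right; lra|right; left; lra|left; lra].
by rewrite -[p]opprK e; apply: plane_eq; rewrite /= ?oppr0.
Qed.

Lemma opp_homeomorphism : homeomorphism (@GRing.opp (plane R)).
Proof.
by exists -%R; split; do ?exact: opprK; move=> z; exact: opp_continuous.
Qed.

Lemma isotopic_turn s (A B : set (plane R)) :
  isotopic A B -> isotopic (turn_map s @` A) (turn_map s @` B).
Proof.
by apply: isotopic_image; [exact: turn_homeomorphism|exact: turn_pegs_inv].
Qed.

Lemma isotopic_opp (A B : set (plane R)) :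
  isotopic A B -> isotopic (-%R @` A) (-%R @` B).
Proof.
by apply: isotopic_image; [exact: opp_homeomorphism|exact: opp_pegs].
Qed.

End Turns.

(** * [L R^-1 L] is isotopic to the half turn *)

Section HalfTurn.
Variable R : realType.
Implicit Types (z w a b c : plane R).

(* [bend] fixes 1 and -1 and sends all other real points into the open upper half
   plane, whose points can be moved freely by [shear], linear above the real axis
   and the identity below. *)
Definition bend z : plane R := Re z +i* (Im z + (Re z ^+ 2 - 1) ^+ 2).
Definition unbend z : plane R := Re z +i* (Im z - (Re z ^+ 2 - 1) ^+ 2).

Definition shear w z : plane R :=
  (Re z + Re w * Num.max 0 (Im z)) +i* (Im z + (Im w - 1) * Num.max 0 (Im z)).
Definition unshear w z : plane R :=
  shear ((- (Re w / Im w)) +i* (Im w)^-1) z.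

(** [unshear (bend w)] takes [bend w] to i, which is [bend 0]. Hence [push w] moves w to 0, keeps -1
    and 1, and depends continuously on w. *)
Definition push w z : plane R := unbend (unshear (bend w) (bend z)).
Definition pull w z : plane R := unbend (shear (bend w) (bend z)).

Lemma bendK : cancel bend unbend.
Proof. by case=> x y; apply: plane_eq; rewrite //= addrK. Qed.

Lemma unbendK : cancel unbend bend.
Proof. by case=> x y; apply: plane_eq; rewrite //= subrK. Qed.

Lemma shear_shear w w' z : 0 < Im w -> 0 < Im w' ->
  Im w' * Im w = 1 -> Re w + Re w' * Im w = 0 -> shear w' (shear w z) = z.
Proof.
case: z => x y w0 w'0 e1 e2; apply: plane_eq => /=; case: (leP y 0) => y0.
- by rewrite !mulr0 !addr0 max_l // !mulr0 !addr0.
- rewrite max_r; last by rewrite mulrBl mul1r addrC subrK mulr_ge0 ?ltW.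
  have -> : Re w' = - Re w * Im w'.
    by rewrite -[LHS]mulr1 -e1; have -> : Re w = - (Re w' * Im w); [lra|ring].
  have : Im w' * Im w * (Re w * y) = Re w * y by rewrite e1 mul1r.
  by lra.
- by rewrite !mulr0 !addr0 max_l // !mulr0 !addr0.
- rewrite max_r; last by rewrite mulrBl mul1r addrC subrK mulr_ge0 ?ltW.
  have : Im w' * Im w * y = y by rewrite e1 mul1r.
  by lra.
Qed.

Lemma pushK w : 0 < Im (bend w) -> cancel (push w) (pull w).
Proof.
move=> w0 z; rewrite /push /pull unbendK /unshear shear_shear ?bendK //=.
- by rewrite invr_gt0.
- by rewrite mulfV // gt_eqF.
- by rewrite addNr.
Qed.

Lemma pullK w : 0 < Im (bend w) -> cancel (pull w) (push w).
Proof.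
move=> w0 z; rewrite /push /pull unbendK /unshear shear_shear ?bendK //=.
- by rewrite invr_gt0.
- by rewrite mulVf // gt_eqF.
- by rewrite mulNr mulfVK ?subrr // gt_eqF.
Qed.

Lemma cont_bend (T : topologicalType) (f : T -> plane R) :
  continuous f -> continuous (fun t => bend (f t)).
Proof.
move=> /continuous_planeP[fR fI]; apply: continuous_plane => //.
apply: cont_add => //; apply: cont_exp; apply: cont_add; last exact: cont_cst.
exact: cont_exp.
Qed.

Lemma cont_unbend (T : topologicalType) (f : T -> plane R) :
  continuous f -> continuous (fun t => unbend (f t)).
Proof.
move=> /continuous_planeP[fR fI]; apply: continuous_plane => //.
apply: cont_add => //; apply: cont_opp; apply: cont_exp; apply: cont_add.
  exact: cont_exp.
exact: cont_cst.
Qed.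

Lemma cont_shear (T : topologicalType) (f g : T -> plane R) :
  continuous f -> continuous g -> continuous (fun t => shear (f t) (g t)).
Proof.
move=> /continuous_planeP[fR fI] /continuous_planeP[gR gI].
have gmax : continuous (fun t => Num.max 0 (Im (g t))).
  by apply: cont_max => //; exact: cont_cst.
apply: continuous_plane; apply: cont_add => //; apply: cont_mul => //.
by apply: cont_add => //; exact: cont_cst.
Qed.

Lemma cont_push (T : topologicalType) (f g : T -> plane R) :
  (forall t, 0 < Im (bend (f t))) ->
  continuous f -> continuous g -> continuous (fun t => push (f t) (g t)).
Proof.
move=> f0 fc gc; apply: cont_unbend; apply: cont_shear; last exact: cont_bend.
have /continuous_planeP[fR fI] := cont_bend fc.
have fV : continuous (fun t => (Im (bend (f t)))^-1).
  by apply: cont_inv => // t; rewrite gt_eqF.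
by apply: continuous_plane => //; apply: cont_opp; apply: cont_mul.
Qed.

Lemma cont_pull (T : topologicalType) (f g : T -> plane R) :
  continuous f -> continuous g -> continuous (fun t => pull (f t) (g t)).
Proof. by move=> fc gc; apply: cont_unbend; apply: cont_shear; exact: cont_bend. Qed.

Lemma push_homeomorphism w : 0 < Im (bend w) -> homeomorphism (push w).
Proof.
move=> w0; exists (pull w); split; [exact: pushK|exact: pullK| |].
  exact: (@cont_push _ (fun _ => w) id (fun _ => w0) (@cont_plane_cst _ _ w)
    (@cont_id _)).
exact: (@cont_pull _ (fun _ => w) id (@cont_plane_cst _ _ w) (@cont_id _)).
Qed.

Lemma push_self w : 0 < Im (bend w) -> push w w = 0.
Proof.
rewrite /push /unshear; case: (bend w) => u v /= v0.
have v_neq0 : v != 0 by rewrite gt_eqF.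
rewrite /unbend /shear /= max_r ?ltW // mulNr mulfVK // subrr expr0n /= sub0r.
have -> : v + (v^-1 - 1) * v = 1 by rewrite mulrBl mulVf // mul1r addrC subrK.
by rewrite sqrrN expr1n subrr.
Qed.

Lemma push_fix w z : Im (bend z) = 0 -> push w z = z.
Proof.
move=> z0; rewrite /push /unshear /shear z0 maxxx !mulr0 !addr0 -[RHS]bendK.
by congr unbend; apply: plane_eq.
Qed.

Lemma push_one w : push w 1 = 1.
Proof. by apply: push_fix; rewrite /= expr1n subrr expr0n addr0. Qed.

Lemma push_opp_one w : push w (-1) = -1.
Proof. by apply: push_fix; rewrite /= oppr0 sqrrN expr1n subrr expr0n addr0. Qed.

Lemma push0 z : push 0 z = z.
Proof.
rewrite /push /unshear /shear /= !expr0n /= sub0r add0r sqrrN expr1n invr1 mul0r.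
by rewrite oppr0 subrr !mul0r !addr0 -[RHS]bendK.
Qed.

Definition spread a c z : plane R := (2 * z - a - c) / (c - a).

(* Takes [a], [b], [c] to -1, 0, 1. *)
Definition normalize a b c z : plane R := push (spread a c b) (spread a c z).

(** Once [a] and [c] are put at -1 and 1, this allows [b] anywhere in the closed upper half plane
    except at these two points. *)
Definition pushable a b c := a != c /\ 0 < Im (bend (spread a c b)).

Lemma spread_homeomorphism a c : a != c -> homeomorphism (spread a c).
Proof.
move=> ac; have ca : c - a != 0 by rewrite subr_eq0 eq_sym.
have two0 : 2 != 0 :> R[i] by rewrite pnatr_eq0.
exists (fun z => (z * (c - a) + a + c) / 2); split=> z.
- by rewrite /spread mulfVK // [_ + a + c]addrAC !subrK mulrC mulKf.
- by rewrite /spread [2 * _]mulrC mulfVK // [_ - a - c]addrAC !addrK mulfK.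
- have cst := @cont_plane_cst R (plane R).
  apply: (continuous_planeM _ (cst (c - a)^-1)).
  apply: (continuous_planeD _ (cst (- c))); apply: (continuous_planeD _ (cst (- a))).
  exact: (continuous_planeM (cst 2) (@cont_id _)).
- have cst := @cont_plane_cst R (plane R).
  apply: (continuous_planeM _ (cst 2^-1)).
  apply: (continuous_planeD _ (cst c)); apply: (continuous_planeD _ (cst a)).
  exact: (continuous_planeM (@cont_id _) (cst (c - a))).
Qed.

Lemma normalize_homeomorphism a b c : pushable a b c -> homeomorphism (normalize a b c).
Proof.
move=> [ac w0]; apply: (homeomorphism_comp (push_homeomorphism w0)).
exact: spread_homeomorphism.
Qed.

Lemma normalize_first a b c : a != c -> normalize a b c a = -1.
Proof.
move=> ac; have ca : c - a != 0 by rewrite subr_eq0 eq_sym.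
rewrite /normalize (_ : spread a c a = -1) ?push_opp_one //.
by rewrite /spread mulr_natl mulr2n addrK -opprB mulNr mulfV.
Qed.

Lemma normalize_second a b c : pushable a b c -> normalize a b c b = 0.
Proof. by move=> [_ ?]; exact: push_self. Qed.

Lemma normalize_third a b c : a != c -> normalize a b c c = 1.
Proof.
move=> ac; have ca : c - a != 0 by rewrite subr_eq0 eq_sym.
rewrite /normalize (_ : spread a c c = 1) ?push_one //.
by rewrite /spread mulr_natl mulr2n addrAC addrK mulfV.
Qed.

Lemma cont_normalize (T : topologicalType) (fa fb fc fz : T -> plane R) :
  (forall t, pushable (fa t) (fb t) (fc t)) ->
  continuous fa -> continuous fb -> continuous fc -> continuous fz ->
  continuous (fun t => normalize (fa t) (fb t) (fc t) (fz t)).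
Proof.
move=> ok ca cb cc cz.
have cN (f : T -> plane R) : continuous f -> continuous (fun t => - f t).
  by move=> cf t; apply: cvgN; exact: cf.
have cs f : continuous f -> continuous (fun t => spread (fa t) (fc t) (f t)).
  move=> cf; apply: continuous_planeM.
    apply: (continuous_planeD _ (cN _ cc)); apply: (continuous_planeD _ (cN _ ca)).
    exact: (continuous_planeM (@cont_plane_cst _ _ 2) cf).
  apply: continuous_planeV; first exact: (continuous_planeD cc (cN _ ca)).
  by move=> t; have [] := ok t; rewrite subr_eq0 eq_sym.
by apply: cont_push; [move=> t; have [] := ok t|exact: cs|exact: cs].
Qed.

Definition deforms (f g : plane R -> plane R) :=
  exists2 H, isotopy_rel_pegs H & forall z, H (1, f z) = g z.

Lemma deforms_trans f g h : deforms f g -> deforms g h -> deforms f h.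
Proof.
move=> [H Hi Hf] [K Ki Kg]; exists (fun tz => K (tz.1, H tz)).
  exact: isotopy_comp.
by move=> z /=; rewrite Hf Kg.
Qed.

Lemma deforms_comp f g h : deforms f g -> deforms (f \o h) (g \o h).
Proof. by move=> [H Hi Hf]; exists H => // z; exact: Hf. Qed.

Lemma deforms_isotopic g (A : set (plane R)) : deforms id g -> isotopic A (g @` A).
Proof.
move=> [H Hi Hf]; apply/isotopicP; exists H; split=> //.
by apply: eq_imagel => z _; exact: Hf.
Qed.

Lemma twist0 m z : twist m 0 z = z.
Proof.
rewrite /twist mul0r /expi cos0 sin0.
by rewrite (_ : 1 +i* 0 = 1) // mul1r addrC subrK.
Qed.

(** The isotopy is N_t T_t N_0^-1, where T_t is the partial twist and N_t normalizes the images of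
    [a], [b], [c] under T_t. However these points move, N_t brings them back to -1, 0, 1, so the
    pegs stay fixed. *)
Lemma deforms_twist m s a b c :
  (forall t, 0 <= t <= 1 -> pushable (twist m (s * t) a) (twist m (s * t) b)
                                     (twist m (s * t) c)) ->
  deforms (normalize a b c)
    (normalize (twist m s a) (twist m s b) (twist m s c) \o twist m s).
Proof.
move=> ok.
have ok0 : pushable a b c by have := ok 0; rewrite mulr0 !twist0 lexx ler01; apply.
have okc t : pushable (twist m (s * clamp t) a) (twist m (s * clamp t) b)
                      (twist m (s * clamp t) c) by apply: ok; exact: clampP.
have [g [gK Kg nc gc]] := normalize_homeomorphism ok0.
exists (fun tz => normalize (twist m (s * clamp tz.1) a)
  (twist m (s * clamp tz.1) b) (twist m (s * clamp tz.1) c)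
  (twist m (s * clamp tz.1) (g tz.2))); last first.
  by move=> z /=; rewrite gK clamp_id ?mulr1 // lexx ler01.
split=> [|t|z|t p pp] /=.
- have cs : continuous (fun tz : R * plane R => s * clamp tz.1).
    apply: cont_mul; first exact: cont_cst.
    exact: (cont_fun_comp (@continuous_clamp R) (@cont_fst _ _)).
  apply: cont_normalize => //; apply: cont_twist => //.
  + exact: cont_plane_cst.
  + exact: cont_plane_cst.
  + exact: cont_plane_cst.
  + exact: (cont_fun_comp gc (@cont_snd _ _)).
- apply: (homeomorphism_comp (normalize_homeomorphism (okc t))).
  apply: (homeomorphism_comp (twist_homeomorphism m (s * clamp t))).
  by exists (normalize a b c); split; [exact: Kg|exact: gK|exact: gc|exact: nc].
- by rewrite clamp_id ?mulr0 ?twist0 ?Kg // lexx ler01.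
- have [ac _] := ok0; have [act _] := okc t.
  case: pp => [[]|] ->.
  + by rewrite -(normalize_first b ac) gK normalize_first // normalize_first.
  + by rewrite -(normalize_second ok0) gK !normalize_second.
  + by rewrite -(normalize_third b ac) gK normalize_third // normalize_third.
Qed.

End HalfTurn.

(** * The loop described by the third peg during [L R^-1 L] *)

Section HalfTurnRelation.
Variable R : realType.

(** q is the position of [b] in the coordinate where [a] and [c] are -1 and 1; stating it as a
    product avoids computing a complex quotient. *)
Lemma pushable_quotient (a b c q : plane R) : a != c ->
  2 * b - a - c = q * (c - a) -> 0 <= Im q ->
  (Im q = 0 -> Re q ^+ 2 != 1) -> pushable a b c.
Proof.
move=> ac e q0 q1; split=> //.
have -> : spread a c b = q by rewrite /spread e mulfK // subr_eq0 eq_sym.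
rewrite /bend /=; have [q00|qn0] := eqVneq (Im q) 0.
  by rewrite q00 add0r lt_def sqr_ge0 andbT sqrf_eq0 subr_eq0; exact: q1.
by rewrite ltr_wpDr ?sqr_ge0 // lt_def qn0.
Qed.

Lemma half_circle (t : R) : 0 <= t <= 1 ->
  0 <= sin (t * pi) /\ cos (t * pi) ^+ 2 + sin (t * pi) ^+ 2 = 1.
Proof.
move=> /andP[t0 t1]; split; last exact: cos2Dsin2.
by rewrite sin_ge0_pi // mulr_ge0 ?pi_ge0 //= ler_piMl ?pi_ge0.
Qed.

Lemma half_circle_end (C S : R) : C ^+ 2 + S ^+ 2 = 1 -> S = 0 -> C = 1 \/ C = -1.
Proof.
move=> + S0; rewrite S0 expr0n addr0 => /eqP; rewrite sqrf_eq1.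
by move=> /orP[] /eqP ->; [left|right].
Qed.

Lemma twist_real (c s x : R) : `|x - c| <= 6 / 10 ->
  twist c s x%:C = (c + cos (s * pi) * (x - c)) +i* (sin (s * pi) * (x - c)).
Proof.
move=> xc; rewrite twist_inner -rmorphB ?normc_real //.
by apply: plane_eq => /=; rewrite !(mulr0, addr0, add0r, subr0).
Qed.

Lemma twist_real_outer (c s x : R) : 9 / 10 <= `|x - c| -> twist c s x%:C = x%:C.
Proof. by move=> xc; apply: twist_outer; rewrite -rmorphB normc_real. Qed.

(** In the three factors the normalized third peg q goes from 0 to -3, from -3 to 3 and from 3 to 0,
    each time through the upper half plane and with real values only at the ends. Here, with e = C +
    i S, q = 3 (e - 1) / (3 + e), and 10 + 6 C is |3 + e|^2. *)
Lemma pushable1 (t : R) : 0 <= t <= 1 ->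
  pushable (twist (- 2^-1) (1 * t) (-1)%:C) (twist (- 2^-1) (1 * t) 0%:C)
    (twist (- 2^-1) (1 * t) 1%:C).
Proof.
move=> /half_circle; rewrite mul1r.
rewrite twist_real; last by rewrite ler0_norm; lra.
rewrite twist_real; last by rewrite ger0_norm; lra.
rewrite twist_real_outer; last by rewrite ger0_norm; lra.
move: (cos _) (sin _) => C S [S0 CS].
have C1 : -1 <= C by nra.
have D0 : 10 + 6 * C != 0 by lra.
apply: (@pushable_quotient _ _ _
  (((6 * C - 6) / (10 + 6 * C)) +i* (12 * S / (10 + 6 * C)))).
- apply/eqP => -[e1 e2]; lra.
- have := divfK D0 (6 * C - 6); have := divfK D0 (12 * S).
  move: (_ / _) (_ / _) => V U hV hU.
  by apply: plane_eq => /=; apply: (mulIf D0); nra.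
- by rewrite /= divr_ge0 ?mulr_ge0 //; lra.
- move=> /= /eqP; rewrite mulf_eq0 invr_eq0 (negPf D0) orbF => /eqP S00.
  have := divfK D0 (6 * C - 6); move: (_ / _) => U hU.
  have /(half_circle_end CS)[C1'|C1'] : S = 0 by lra.
  + by have -> : U = 0; [nra|apply/eqP; lra].
  + by have -> : U = -3; [nra|apply/eqP; lra].
Qed.

(** Now the outer two points rotate while the third peg lies outside the twisted disc, so q is -3
    times the conjugate of e. *)
Lemma pushable2 (t : R) : 0 <= t <= 1 ->
  pushable (twist 2^-1 (1 * t) 0%:C) (twist 2^-1 (1 * t) (-1)%:C)
    (twist 2^-1 (1 * t) 1%:C).
Proof.
move=> /half_circle; rewrite mul1r.
rewrite twist_real; last by rewrite ler0_norm; lra.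
rewrite twist_real_outer; last by rewrite ler0_norm; lra.
rewrite twist_real; last by rewrite ger0_norm; lra.
move: (cos _) (sin _) => C S [S0 CS].
apply: (@pushable_quotient _ _ _ ((- 3 * C) +i* (3 * S))).
- apply/eqP => -[e1 e2]; nra.
- by apply: plane_eq => /=; nra.
- by rewrite /= mulr_ge0 //; lra.
- move=> /= S00; have /(half_circle_end CS)[->|->] : S = 0 by lra.
  + by apply/eqP; lra.
  + by apply/eqP; lra.
Qed.

(** Here q = 3 (1 + e) / (3 - e), and 10 - 6 C is |3 - e|^2. *)
Lemma pushable3 (t : R) : 0 <= t <= 1 ->
  pushable (twist (- 2^-1) (1 * t) 1%:C) (twist (- 2^-1) (1 * t) (-1)%:C)
    (twist (- 2^-1) (1 * t) 0%:C).
Proof.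
move=> /half_circle; rewrite mul1r.
rewrite twist_real_outer; last by rewrite ger0_norm; lra.
rewrite twist_real; last by rewrite ler0_norm; lra.
rewrite twist_real; last by rewrite ger0_norm; lra.
move: (cos _) (sin _) => C S [S0 CS].
have C1 : C <= 1 by nra.
have D0 : 10 - 6 * C != 0 by lra.
apply: (@pushable_quotient _ _ _
  (((6 + 6 * C) / (10 - 6 * C)) +i* (12 * S / (10 - 6 * C)))).
- apply/eqP => -[e1 e2]; lra.
- have := divfK D0 (6 + 6 * C); have := divfK D0 (12 * S).
  move: (_ / _) (_ / _) => V U hV hU.
  by apply: plane_eq => /=; apply: (mulIf D0); nra.
- by rewrite /= divr_ge0 ?mulr_ge0 //; lra.
- move=> /= /eqP; rewrite mulf_eq0 invr_eq0 (negPf D0) orbF => /eqP S00.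
  have := divfK D0 (6 + 6 * C); move: (_ / _) => U hU.
  have /(half_circle_end CS)[C1'|C1'] : S = 0 by lra.
  + by have -> : U = 3; [nra|apply/eqP; lra].
  + by have -> : U = 0; [nra|apply/eqP; lra].
Qed.

Lemma normalize_id (z : plane R) : normalize (-1) 0 1 z = z.
Proof.
rewrite /normalize /spread mulr0 sub0r opprK subrr mul0r push0 addrK.
by rewrite -[1 + 1]/2 mulrC mulKf // pnatr_eq0.
Qed.

Lemma normalize_opp (z : plane R) : normalize 1 0 (-1) z = - z.
Proof.
rewrite /normalize /spread mulr0 sub0r opprK addNr mul0r push0 subrK -opprD.
by rewrite -[1 + 1]/2 invrN mulrN mulrC mulKf // pnatr_eq0.
Qed.

Lemma deforms_half_turn :
  deforms id (fun z : plane R =>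
    - turn_map LeftTurn (turn_map RightTurnInv (turn_map LeftTurn z))).
Proof.
have pegE x y c : c = 2^-1 \/ c = - 2^-1 -> x = -1 \/ x = 0 \/ x = 1 ->
    y = (if x == - 2 * c then x else 2 * c - x) -> twist c 1 x%:C = y%:C :> plane R.
  by move=> hc hx ->; apply: twist_peg => //; left.
have eL_1 : twist (- 2^-1) 1 (-1)%:C = 0%:C :> plane R.
  apply: pegE; [by right|by left|].
  by case: eqP => [|_]; lra.
have eL0 : twist (- 2^-1) 1 0%:C = (-1)%:C :> plane R.
  apply: pegE; [by right|by right; left|].
  by case: eqP => [|_]; lra.
have eL1 : twist (- 2^-1) 1 1%:C = 1%:C :> plane R.
  apply: pegE; [by right|by right; right|].
  by case: eqP => [|[]]; lra.
have eR_1 : twist 2^-1 1 (-1)%:C = (-1)%:C :> plane R.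
  apply: pegE; [by left|by left|].
  by case: eqP => [|[]]; lra.
have eR0 : twist 2^-1 1 0%:C = 1%:C :> plane R.
  apply: pegE; [by left|by right; left|].
  by case: eqP => [|_]; lra.
have eR1 : twist 2^-1 1 1%:C = 0%:C :> plane R.
  apply: pegE; [by left|by right; right|].
  by case: eqP => [|_]; lra.
(* The triple (a, b, c) follows the pegs: it starts at (-1, 0, 1), then becomes (0, -1, 1), (1, -1,
   0) and finally (1, 0, -1), whose normalization is z |-> -z. *)
have := deforms_twist pushable1; rewrite eL_1 eL0 eL1 => d1.
have := deforms_twist pushable2; rewrite eR_1 eR0 eR1 => d2.
have := deforms_twist pushable3; rewrite eL_1 eL0 eL1 => d3.
have e1 : (fun z : plane R =>
    - turn_map LeftTurn (turn_map RightTurnInv (turn_map LeftTurn z))) =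
    normalize 1%:C 0%:C (-1)%:C \o twist (- 2^-1) 1 \o (twist 2^-1 1 \o twist (- 2^-1) 1).
  by apply/funext => z /=; rewrite rmorphN1 normalize_opp.
rewrite e1.
apply: (deforms_trans _ (deforms_comp _ d3)).
rewrite -[X in deforms _ X]/((normalize 1%:C (-1)%:C 0%:C \o twist 2^-1 1) \o
  twist (- 2^-1) 1).
apply: (deforms_trans _ (deforms_comp _ d2)).
rewrite (_ : id = normalize (-1)%:C 0%:C 1%:C) //.
by apply/funext => z; rewrite rmorphN1 normalize_id.
Qed.

Lemma half_turn_isotopic (A : set (plane R)) :
  isotopic A ((fun z =>
    - turn_map LeftTurn (turn_map RightTurnInv (turn_map LeftTurn z))) @` A).
Proof. exact: deforms_isotopic deforms_half_turn. Qed.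

End HalfTurnRelation.

(** * Words *)

Local Arguments turn_map : simpl never.

Section Words.
Variable R : realType.
Implicit Types (t w : taffy_pull) (s : turn).

Definition taffy_pair t : int * int := foldl (fun ab s => turn_rule s ab) (0, 1) t.

Lemma taffy_pair_rcons t s : taffy_pair (rcons t s) = turn_rule s (taffy_pair t).
Proof. exact: foldl_rcons. Qed.

Lemma taffy_pair_neq0 t : taffy_pair t != (0, 0).
Proof.
elim/last_ind: t => // t s IH; rewrite taffy_pair_rcons; exact: turn_rule_neq0.
Qed.

Lemma taffy_numberE t : taffy_number t = Defs.frac (taffy_pair t).
Proof.
elim/last_ind: t => // t s IH; rewrite /taffy_number foldl_rcons -/(taffy_number t).
by rewrite IH taffy_pair_rcons turn_fracE ?taffy_pair_neq0.
Qed.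

Definition pull_inv t : taffy_pull := rev (map turn_inv t).

Lemma turn_ruleK s : cancel (turn_rule s) (turn_rule (turn_inv s)).
Proof. by case: s => -[a b] /=; congr pair; lia. Qed.

Definition rules t (ab : int * int) := foldl (fun ab s => turn_rule s ab) ab t.

Lemma rulesK t : cancel (rules t) (rules (pull_inv t)).
Proof.
elim: t => // s t IH ab; rewrite /pull_inv /rules /= rev_cons foldl_rcons.
by rewrite -/(rules _ _) -/(rules _ _) IH turn_ruleK.
Qed.

Lemma pull_invK : involutive pull_inv.
Proof.
by move=> t; rewrite /pull_inv map_rev revK -map_comp -[RHS]map_id; apply: eq_map; case.
Qed.

(** Every rule acts by a matrix of determinant 1. *)
Lemma rules_det t (u v : int * int) :
  (rules t u).1 * (rules t v).2 - (rules t u).2 * (rules t v).1 =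
  u.1 * v.2 - u.2 * v.1.
Proof.
elim: t u v => // s t IH u v; rewrite /rules /= -/(rules _ _) -/(rules _ _) IH.
by case: u v => a b [c d]; case: s => /=; ring.
Qed.

Definition pull_fun t (z : plane R) := foldl (fun z s => turn_map s z) z t.

Lemma pull_mapE t : pull_map t = pull_fun t.
Proof.
elim/last_ind: t => // t s IH; rewrite /pull_map /pull_fun foldl_rcons.
by rewrite -/(pull_map t) IH; apply/funext => z; rewrite foldl_rcons.
Qed.

Lemma pull_fun_cat t1 t2 : pull_fun (t1 ++ t2) = pull_fun t2 \o pull_fun t1.
Proof. by apply/funext => z; exact: foldl_cat. Qed.

Lemma pull_funK t : cancel (pull_fun t) (pull_fun (pull_inv t)).
Proof.
elim: t => // s t IH z; rewrite /pull_inv /pull_fun /= rev_cons foldl_rcons.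
by rewrite -/(pull_fun _ _) -/(pull_fun _ _) IH turn_mapK.
Qed.

Lemma pull_fun_homeomorphism t : homeomorphism (pull_fun t).
Proof.
elim/last_ind: t => [|t s IH]; first exact: homeomorphism_id.
have -> : pull_fun (rcons t s) = turn_map s \o pull_fun t.
  by apply/funext => z; exact: foldl_rcons.
exact: (@homeomorphism_comp R _ _ (@turn_homeomorphism R s) IH).
Qed.

Lemma pull_fun_pegs t (p : plane R) : pegs (pull_fun t p) <-> pegs p.
Proof.
elim/last_ind: t => // t s IH; rewrite /pull_fun foldl_rcons -/(pull_fun _ _).
by rewrite -IH; split; [exact: turn_pegs_inv|exact: turn_pegs].
Qed.

Lemma isotopic_pull t (A B : set (plane R)) :
  isotopic A B -> isotopic (pull_fun t @` A) (pull_fun t @` B).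
Proof.
apply: isotopic_image; first exact: pull_fun_homeomorphism.
by move=> p /pull_fun_pegs.
Qed.

Lemma taffy_arcE t : @taffy_arc R t = pull_fun t @` @initial_arc R.
Proof. by rewrite /taffy_arc pull_mapE. Qed.

Lemma taffy_arc_cat t1 t2 : @taffy_arc R (t1 ++ t2) = pull_fun t2 @` @taffy_arc R t1.
Proof. by rewrite !taffy_arcE pull_fun_cat image_comp. Qed.

Lemma taffy_arc_rcons t s : @taffy_arc R (rcons t s) = turn_map s @` @taffy_arc R t.
Proof. by rewrite -cats1 taffy_arc_cat. Qed.

Lemma taffy_arc_nil : taffy_arc [::] = @initial_arc R.
Proof. exact: image_id. Qed.

Definition positive_word w :=
  all (fun s => if s is (LeftTurn | RightTurn) then true else false) w.

Lemma positive_rcons w s : positive_word (rcons w s) =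
  (if s is (LeftTurn | RightTurn) then positive_word w else false).
Proof. by rewrite /positive_word all_rcons; case: s. Qed.

Lemma twist_initial_arc (u : R) : u = 1 \/ u = -1 ->
  twist (- 2^-1) u @` @initial_arc R = @initial_arc R.
Proof.
move=> u1.
have E x : -1 <= x <= 0 -> twist (- 2^-1) u x%:C = (- 1 - x)%:C.
  move=> x01; rewrite twist_half // -?rmorphB ?normc_real ?ler_norml; last by lra.
  by congr (_%:C); lra.
apply/seteqP; split=> [_ [_ [x x01 <-] <-]|_ [x x01 <-]].
  move: x01; rewrite /= in_itv /= => x01.
  by exists (-1 - x); rewrite ?E //= in_itv /=; lra.
move: x01; rewrite /= in_itv /= => x01.
exists (-1 - x)%:C; last by rewrite E; [congr (_%:C)|]; lra.
by exists (-1 - x) => //=; rewrite in_itv /=; lra.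
Qed.

Lemma left_turn_initial_arc : turn_map LeftTurn @` @initial_arc R = @initial_arc R.
Proof. by apply: twist_initial_arc; left. Qed.

Lemma left_turn_inv_initial_arc : turn_map LeftTurnInv @` @initial_arc R = @initial_arc R.
Proof. by apply: twist_initial_arc; right. Qed.

(* Both relations below are instances of [L R^-1 L = rho], where the half turn
   [rho] of the plane conjugates [L] to [R^-1]. *)
Lemma right_inv_left (A : set (plane R)) :
  isotopic (turn_map RightTurnInv @` (turn_map LeftTurn @` A))
           (-%R @` (turn_map RightTurn @` A)).
Proof.
have := isotopic_turn LeftTurnInv (isotopic_opp (half_turn_isotopic A)).
rewrite !image_comp => h; apply/isotopic_sym.
rewrite (_ : -%R \o _ = turn_map LeftTurnInv \o -%R); last first.
  by apply/funext => z /=; rewrite -(turn_map_flip RightTurn).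
rewrite (_ : _ \o turn_map LeftTurn = turn_map LeftTurnInv \o (-%R \o (fun z =>
    - turn_map LeftTurn (turn_map RightTurnInv (turn_map LeftTurn z))))) //.
by apply/funext => z /=; rewrite opprK (turn_mapK LeftTurn).
Qed.

Lemma left_inv_right (A : set (plane R)) :
  isotopic (turn_map LeftTurnInv @` (turn_map RightTurn @` A))
           (-%R @` (turn_map LeftTurn @` A)).
Proof.
have := right_inv_left (turn_map LeftTurnInv @` (turn_map RightTurn @` A)).
move=> /isotopic_opp/(isotopic_turn RightTurnInv) h; apply/isotopic_sym; move: h.
rewrite !image_comp; congr isotopic; apply: eq_imagel => z _ /=.
  by rewrite (turn_mapK LeftTurnInv) (turn_mapK RightTurn) -(turn_map_flip LeftTurn).
by rewrite opprK (turn_mapK RightTurn).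
Qed.

(** The composite of the rules for [L], [R^-1] and [L], hence the action of [rho] on vectors. Its
    square is -1 although [rho] is an involution, which is why vectors are compared up to sign. *)
Definition half_turn_rule (ab : int * int) : int * int := (- ab.2, ab.1).

Definition up_to_sign (ab cd : int * int) := ab = cd \/ ab = (- cd.1, - cd.2).

(* The arc [A] with coordinates [ab] is that of the positive word [w], turned by
   [rho] if [h]. *)
Definition normal_form (A : set (plane R)) (ab : int * int) w (h : bool) :=
  [/\ positive_word w,
      isotopic A (if h then -%R @` @taffy_arc R w else @taffy_arc R w) &
      up_to_sign ab (if h then half_turn_rule (taffy_pair w) else taffy_pair w)].

(** An inverse turn either cancels the last letter or, by L^-1 R = rho L and R^-1 L = rho R,
    replaces it at the price of a half turn; earlier letters are untouched. *)
Lemma normal_form_turn s w : positive_word w -> exists w' h,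
  normal_form (turn_map s @` taffy_arc w) (turn_rule s (taffy_pair w)) w' h.
Proof.
move=> wp.
have pos u s' : positive_word (rcons u s') ->
    normal_form (turn_map s' @` taffy_arc u) (turn_rule s' (taffy_pair u))
      (rcons u s') false.
  move=> up; split=> //; last by left; rewrite taffy_pair_rcons.
  by rewrite taffy_arc_rcons; exact: isotopic_refl.
have neg A u s' (ab : int * int) : positive_word (rcons u s') ->
    isotopic A (-%R @` (turn_map s' @` taffy_arc u)) ->
    up_to_sign ab (half_turn_rule (turn_rule s' (taffy_pair u))) ->
    normal_form A ab (rcons u s') true.
  by move=> up iA abe; split=> //; rewrite ?taffy_arc_rcons ?taffy_pair_rcons.
have cancel s' u : positive_word u ->
    normal_form (turn_map (turn_inv s') @` taffy_arc (rcons u s'))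
      (turn_rule (turn_inv s') (taffy_pair (rcons u s'))) u false.
  move=> up; split=> //; last by left; rewrite taffy_pair_rcons turn_ruleK.
  rewrite taffy_arc_rcons image_comp -[X in isotopic _ X]image_id.
  rewrite (_ : _ \o _ = id); first exact: isotopic_refl.
  by apply/funext => z; exact: turn_mapK.
case: s.
- by exists (rcons w LeftTurn), false; apply: pos; rewrite positive_rcons.
- by exists (rcons w RightTurn), false; apply: pos; rewrite positive_rcons.
- case/lastP: w wp => [_|u s wp].
    exists [::], false; rewrite taffy_arc_nil left_turn_inv_initial_arc.
    by split=> //; [rewrite taffy_arc_nil; exact: isotopic_refl|left].
  have := wp; rewrite positive_rcons; case: s wp => // wp up.
    by exists u, false; exact: cancel.
  exists (rcons u LeftTurn), true; apply: neg; first by rewrite positive_rcons.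
    by rewrite taffy_arc_rcons; exact: left_inv_right.
  rewrite taffy_pair_rcons; case: (taffy_pair u) => a b.
  by right; rewrite /half_turn_rule /=; congr pair; lia.
- case/lastP: w wp => [_|u s wp].
    (* With no last letter available, one is created: the initial arc equals its own left turn, and
       R^-1 L = rho R applies. *)
    exists [:: RightTurn], true; apply: (@neg _ [::]) => //; last first.
      by left.
    by rewrite !taffy_arc_nil -{1}left_turn_initial_arc; exact: right_inv_left.
  have := wp; rewrite positive_rcons; case: s wp => // wp up.
    exists (rcons u RightTurn), true; apply: neg; first by rewrite positive_rcons.
      by rewrite taffy_arc_rcons; exact: right_inv_left.
    rewrite taffy_pair_rcons; case: (taffy_pair u) => a b.
    by left; rewrite /half_turn_rule /=; congr pair; lia.
  by exists u, false; exact: cancel.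
Qed.

Lemma up_to_sign_trans ab cd ef :
  up_to_sign ab cd -> up_to_sign cd ef -> up_to_sign ab ef.
Proof.
by move=> -[->|->] -[->|->] /=; rewrite ?opprK; [left|right|right|left; case: ef].
Qed.

Lemma up_to_sign_turn s ab cd :
  up_to_sign ab cd -> up_to_sign (turn_rule s ab) (turn_rule s cd).
Proof.
case: cd => c d [->|->]; [by left|right].
by case: s => /=; congr pair; lia.
Qed.

Lemma up_to_sign_half ab cd :
  up_to_sign ab cd -> up_to_sign (half_turn_rule ab) (half_turn_rule cd).
Proof. by case: cd => c d [->|->]; [left|right]. Qed.

Lemma turn_rule_half s ab :
  turn_rule s (half_turn_rule ab) = half_turn_rule (turn_rule (turn_flip s) ab).
Proof. by case: ab => a b; case: s; rewrite /half_turn_rule /=; congr pair; lia. Qed.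

Lemma image_opp_opp (A : set (plane R)) : -%R @` (-%R @` A) = A.
Proof.
rewrite image_comp -[RHS]image_id; apply: eq_imagel => z _; exact: opprK.
Qed.

Lemma image_turn_opp s (A : set (plane R)) :
  turn_map s @` (-%R @` A) = -%R @` (turn_map (turn_flip s) @` A).
Proof.
rewrite !image_comp; apply: eq_imagel => z _; rewrite /comp -turn_map_flip.
by case: s.
Qed.

Lemma normal_form_exists t : exists w h, normal_form (taffy_arc t) (taffy_pair t) w h.
Proof.
elim/last_ind: t => [|t s [w [h [wp iw ew]]]].
  by exists [::], false; split=> //; [exact: isotopic_refl|left].
rewrite taffy_arc_rcons taffy_pair_rcons.
move/(up_to_sign_turn s) : ew; move/(isotopic_turn s) : iw.
case: h; last first.
  move=> iw ew; have [w' [h [wp' iw' ew']]] := normal_form_turn s wp.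
  exists w', h; split=> //; first exact: isotopic_trans iw iw'.
  exact: up_to_sign_trans ew ew'.
rewrite image_turn_opp turn_rule_half => iw ew.
have [w' [h [wp' iw' ew']]] := normal_form_turn (turn_flip s) wp.
exists w', (~~ h); split=> //.
  apply: isotopic_trans iw _; move/isotopic_opp : iw'.
  by case: (h) => //=; rewrite image_opp_opp.
apply: up_to_sign_trans ew _; move/up_to_sign_half : ew'.
case: (h) => //= e; apply: up_to_sign_trans e _.
by right.
Qed.

Lemma positive_pair w : positive_word w -> 0 <= (taffy_pair w).1 /\ 0 < (taffy_pair w).2.
Proof.
elim/last_ind: w => // w s IH; rewrite positive_rcons taffy_pair_rcons.
by case: s => // /IH; case: (taffy_pair w) => a b /= [a0 b0]; split; lia.
Qed.

Lemma positive_word_zero w : positive_word w -> (taffy_pair w).1 = 0 ->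
  taffy_arc w = @initial_arc R.
Proof.
elim/last_ind: w => [_ _|w s IH]; first exact: taffy_arc_nil.
rewrite positive_rcons taffy_pair_rcons taffy_arc_rcons.
case: s => // wp; have := positive_pair wp; have := IH wp.
  case: (taffy_pair w) => a b /= IHa _ a0.
  by rewrite IHa // left_turn_initial_arc.
by case: (taffy_pair w) => a b /= _ [? ?] ?; exfalso; lia.
Qed.

(** A half turn in the normal form would make the first coordinate equal to b up to sign, and b > 0
    for a positive word. So there is none. *)
Lemma taffy_arc_zero t : (taffy_pair t).1 = 0 -> isotopic (taffy_arc t) (@initial_arc R).
Proof.
move=> t0; have [w [[] [wp iw ew]]] := normal_form_exists t.
  have [a0 b0] := positive_pair wp.
  by exfalso; case: ew t0 => -> /=; lia.
rewrite -(positive_word_zero wp) //.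
by case: ew t0 => -> //= ?; lia.
Qed.

End Words.

(** * Lifts of paths *)

Section Lifts.
Variable R : realType.
Implicit Types z : plane R.

Definition mirror z : plane R := (- Re z) +i* Im z.

(* Near the twisted disc, [y] is the angle around -1/2, measured from the left, so
   that the left turn rotates it; [cosy] is -1 on (-oo, -1], 1 on [0, 1] and lies
   strictly in between elsewhere. The signs are opposite to those of [cos y]. *)
Definition cosy z : R :=
  Num.min (Re z + 2^-1) (3 / 2) / Num.max (normc (z - (- 2^-1)%:C)) 2^-1.
Definition cosx z : R := cosy (mirror z).

Lemma center_sub z : z - (- 2^-1)%:C = (Re z + 2^-1) +i* Im z.
Proof. by case: z => a b; apply: plane_eq; rewrite /= ?opprK ?subr0 // oppr0 addr0. Qed.

Lemma normcP z : 0 <= normc z /\ normc z ^+ 2 = Re z ^+ 2 + Im z ^+ 2.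
Proof.
by case: z => a b /=; rewrite sqrtr_ge0 sqr_sqrtr // addr_ge0 ?sqr_ge0.
Qed.

Lemma cosyP z : let u := Re z + 2^-1 in let v := Im z in
  exists r, [/\ r = normc (z - (- 2^-1)%:C), 0 <= r, r ^+ 2 = u ^+ 2 + v ^+ 2 &
     cosy z * Num.max r 2^-1 = Num.min u (3 / 2)].
Proof.
have [r0 r2] := normcP (z - (- 2^-1)%:C).
exists (normc (z - (- 2^-1)%:C)); split=> //; first by rewrite r2 center_sub.
by rewrite /cosy divfK // gt_eqF // lt_max invr_gt0 ltr0n orbT.
Qed.

Lemma max_half_cases (r : R) : let m := Num.max r 2^-1 in
  (m = r /\ 2^-1 <= r) \/ (m = 2^-1 /\ r <= 2^-1).
Proof. by rewrite /=; case: (leP r 2^-1) => h; [right|left]; split=> //; lra. Qed.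

Lemma min_threehalf_cases (u : R) : let m := Num.min u (3 / 2) in
  (m = u /\ u <= 3 / 2) \/ (m = 3 / 2 /\ 3 / 2 <= u).
Proof. by rewrite /=; case: (leP u (3 / 2)) => h; [left|right]; split=> //; lra. Qed.

(** With r = |z + 1/2| one has |u| <= r, with equality only on the real axis. The cut at 1/2 makes
    the value 1 begin at the peg 0 and the value -1 begin at the peg -1; the cut at 3/2 ends the
    value 1 at the peg 1. *)
Lemma cosy_spec z : let u := Re z + 2^-1 in
  [/\ -1 <= cosy z <= 1,
      cosy z = 1 -> Im z = 0 /\ 0 <= Re z <= 1 &
      cosy z = -1 -> Im z = 0 /\ Re z <= -1].
Proof.
have [r [_ r0 r2]] := cosyP z.
move: (cosy z) (Im z) r2 => c v r2.
set u := Re z + 2^-1 in r2 *; have -> : Re z = u - 2^-1 by rewrite addrK.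
have ur : -r <= u <= r by apply/andP; split; nra.
have [] := max_half_cases r; have [] := min_threehalf_cases u => -[-> hu] [-> hr] e.
- split; first by apply/andP; split; nra.
  + move=> c1; rewrite c1 mul1r in e; split; last by lra.
    by apply/eqP; rewrite -sqrf_eq0; apply/eqP; nra.
  + move=> c1; rewrite c1 mulN1r in e; split; last by lra.
    by apply/eqP; rewrite -sqrf_eq0; apply/eqP; nra.
- split; first by apply/andP; split; nra.
  + move=> c1; rewrite c1 mul1r in e; split; last by lra.
    by apply/eqP; rewrite -sqrf_eq0; apply/eqP; nra.
  + move=> c1; rewrite c1 mulN1r in e; exfalso; lra.
- split; first by apply/andP; split; nra.
  + move=> c1; rewrite c1 mul1r in e; split; last by lra.
    by apply/eqP; rewrite -sqrf_eq0; apply/eqP; nra.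
  + move=> c1; rewrite c1 mulN1r in e; split; last by lra.
    by apply/eqP; rewrite -sqrf_eq0; apply/eqP; nra.
- exfalso; lra.
Qed.

Lemma cosy_eq1 z : Im z = 0 -> 0 <= Re z <= 1 -> cosy z = 1.
Proof.
move=> z0 zI; have [r [_ r0]] := cosyP z.
rewrite z0 expr0n addr0 => r2.
have -> : r = Re z + 2^-1 by nra.
by rewrite max_l ?min_l; [|lra..]; move=> /(canRL (mulfK _)) ->; rewrite ?divff; lra.
Qed.

Lemma cosy_eqN1 z : Im z = 0 -> Re z <= -1 -> cosy z = -1.
Proof.
move=> z0 zI; have [r [_ r0]] := cosyP z.
rewrite z0 expr0n addr0 => r2.
have -> : r = - (Re z + 2^-1) by nra.
rewrite max_l ?min_l; [|lra..]; move=> e.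
by apply: (@mulIf _ (- (Re z + 2^-1))); lra.
Qed.

Lemma mirrorK : involutive mirror.
Proof. by case=> a b; apply: plane_eq; rewrite //= opprK. Qed.

Lemma cosx_mirror z : cosx (mirror z) = cosy z.
Proof. by rewrite /cosx mirrorK. Qed.

Lemma cosx_spec z :
  [/\ -1 <= cosx z <= 1,
      cosx z = 1 -> Im z = 0 /\ -1 <= Re z <= 0 &
      cosx z = -1 -> Im z = 0 /\ 1 <= Re z].
Proof.
rewrite /cosx; have [h0 h1 h2] := cosy_spec (mirror z); split=> //.
  by move=> /h1[? /=]; split=> //; lra.
by move=> /h2[? /=]; split=> //; lra.
Qed.

Lemma cosx_eq1 z : Im z = 0 -> -1 <= Re z <= 0 -> cosx z = 1.
Proof. by move=> z0 zI; apply: cosy_eq1 => //=; lra. Qed.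

Lemma cosx_eqN1 z : Im z = 0 -> 1 <= Re z -> cosx z = -1.
Proof. by move=> z0 zI; apply: cosy_eqN1 => //=; lra. Qed.

Definition sinx z : R := Num.sqrt (1 - cosx z ^+ 2).
Definition siny z : R := Num.sqrt (1 - cosy z ^+ 2).
(** The sign orients the quotient so that a left turn adds x to y, as the rule for [L] does; the
    opposite sign would make it subtract. *)
Definition sinxy z : R := - (Num.sg (Im z) * (sinx z * siny z)).

Lemma sinx_sqr z : sinx z ^+ 2 = 1 - cosx z ^+ 2.
Proof. by have [? _ _] := cosx_spec z; rewrite sqr_sqrtr //; nra. Qed.

Lemma siny_sqr z : siny z ^+ 2 = 1 - cosy z ^+ 2.
Proof. by have [? _ _] := cosy_spec z; rewrite sqr_sqrtr //; nra. Qed.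

Lemma sinx_ge0 z : 0 <= sinx z. Proof. exact: sqrtr_ge0. Qed.
Lemma siny_ge0 z : 0 <= siny z. Proof. exact: sqrtr_ge0. Qed.

Lemma sinx_siny_real z : Im z = 0 -> sinx z * siny z = 0.
Proof.
move=> z0; rewrite /sinx /siny; have [z1|z1] := leP (Re z) (-1).
  by rewrite (cosy_eqN1 z0) // sqrrN expr1n subrr sqrtr0 mulr0.
have [z2|z2] := leP (Re z) 0.
  by rewrite (cosx_eq1 z0) ?expr1n ?subrr ?sqrtr0 ?mul0r //; lra.
have [z3|z3] := leP (Re z) 1.
  by rewrite (cosy_eq1 z0) ?expr1n ?subrr ?sqrtr0 ?mulr0 //; lra.
by rewrite (cosx_eqN1 z0) ?sqrrN ?expr1n ?subrr ?sqrtr0 ?mul0r //; lra.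
Qed.

Lemma sinxy_sqr z : sinxy z ^+ 2 = (1 - cosx z ^+ 2) * (1 - cosy z ^+ 2).
Proof.
rewrite -sinx_sqr -siny_sqr /sinxy sqrrN !exprMn.
have [z0|z0] := eqVneq (Im z) 0.
  have /(congr1 (fun a => a ^+ 2)) := sinx_siny_real z0.
  by rewrite exprMn expr0n => ->; rewrite mulr0.
by rewrite sqr_sg z0 mul1r.
Qed.

Section Continuity.
Variable T : topologicalType.

Lemma cont_mirror (f : T -> plane R) : continuous f -> continuous (fun t => mirror (f t)).
Proof.
move=> /continuous_planeP[fR fI]; apply: continuous_plane; last exact: fI.
exact: cont_opp.
Qed.

Lemma cont_cosy (f : T -> plane R) : continuous f -> continuous (fun t => cosy (f t)).
Proof.
move=> fc; have /continuous_planeP[fR fI] := fc; apply: cont_mul.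
  apply: cont_min; last exact: cont_cst.
  exact: (cont_add fR (@cont_cst R T 2^-1)).
apply: cont_inv => [|t]; last by rewrite gt_eqF // lt_max invr_gt0 ltr0n orbT.
apply: cont_max; last exact: cont_cst.
by apply: cont_normc; exact: (continuous_planeD fc (@cont_plane_cst R T _)).
Qed.

Lemma cont_cosx (f : T -> plane R) : continuous f -> continuous (fun t => cosx (f t)).
Proof. by move=> fc; apply: cont_cosy; exact: cont_mirror. Qed.

Lemma cont_sinxy (f : T -> plane R) : continuous f -> continuous (fun t => sinxy (f t)).
Proof.
move=> fc; have /continuous_planeP[_ fI] := fc; apply: cont_opp; apply: cont_sg => //.
  have cs (g : T -> R) : continuous g -> continuous (fun t => Num.sqrt (1 - g t ^+ 2)).
    move=> gc; apply: (cont_fun_comp (@sqrt_continuous R)).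
    by apply: (cont_add (@cont_cst R T 1)); apply: cont_opp; exact: cont_exp.
  by apply: cont_mul; apply: cs; [exact: cont_cosx|exact: cont_cosy].
by move=> t; exact: sinx_siny_real.
Qed.

Lemma cont_acos (f : T -> R) : continuous f -> (forall t, -1 <= f t <= 1) ->
  continuous (fun t => acos (f t)).
Proof.
move=> fc f1; have ac : {within `[-1, 1], continuous (@acos R)}; last first.
  by apply: (cont_within_comp ac fc) => t; rewrite /= in_itv /=; exact: f1.
have := @segment_can_ge_continuous R 0 pi cos (@acos R) (pi_ge0 R) _ (@cosK R).
rewrite cospi cos0; apply.
by apply: continuous_subspaceT => x; exact: continuous_cos.
Qed.

End Continuity.

(** The point (x, y) of R^2 lies over z. *)
Definition angles z (x y : R) :=
  [/\ cos x = - cosx z, cos y = - cosy z & sin x * sin y = sinxy z].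

Lemma angles_mirror z x y : angles z x y -> angles (mirror z) y x.
Proof.
move=> [cx cy sxy]; split; [by rewrite cosx_mirror|by []|].
by rewrite mulrC sxy /sinxy /sinx /siny cosx_mirror /= [X in _ * X]mulrC.
Qed.

(* If [h] in [0, pi] is [x] up to sign and period, then [x + sg (sin x) (k - h)]
   is [k] up to the same sign and period. *)
Lemma shift_angle (x h k : R) : cos x = cos h -> sin x = Num.sg (sin x) * sin h ->
  (sin x = 0 -> cos k = cos x /\ sin k = 0) ->
  cos (x + Num.sg (sin x) * (k - h)) = cos k /\
  sin (x + Num.sg (sin x) * (k - h)) = Num.sg (sin x) * sin k.
Proof.
move=> cx sx x0; have [s0|s0|s0] := ltrgt0P (sin x).
- move: sx; rewrite gtr0_sg // !mul1r => sx.
  have -> : x + (k - h) = k + (x - h) by rewrite addrCA addrA.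
  rewrite !(cosD, sinD, cosN, sinN) cx sx; have := cos2Dsin2 h.
  move: (cos h) (sin h) (cos k) (sin k) => a b c d e.
  split; [transitivity (c * (a ^+ 2 + b ^+ 2))|transitivity (d * (a ^+ 2 + b ^+ 2))];
    by [ring|rewrite e mulr1].
- move: sx; rewrite ltr0_sg // !mulN1r => sx.
  have -> : x - (k - h) = (x + h) - k by rewrite opprB addrA.
  rewrite !(cosD, sinD, cosN, sinN) cx sx; have := cos2Dsin2 h.
  move: (cos h) (sin h) (cos k) (sin k) => a b c d e.
  split; [transitivity (c * (a ^+ 2 + b ^+ 2))|transitivity (- (d * (a ^+ 2 + b ^+ 2)))];
    by [ring|rewrite e mulr1 ?mulN1r].
- have [-> _] := x0 s0; rewrite s0 sgr0 !mul0r addr0; split=> //.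
Qed.

Definition twist_angle z : R := theta (normc (z - (- 2^-1)%:C)).
(** The representative in [0, pi] of the first coordinates over z, which agree up to sign and
    period. *)
Definition xhat z : R := acos (- cosx z).

Lemma cos_xhat z : cos (xhat z) = - cosx z.
Proof. by have [? _ _] := cosx_spec z; rewrite /xhat acosK // in_itv /=; lra. Qed.

Lemma sin_xhat z : sin (xhat z) = sinx z.
Proof. by have [? _ _] := cosx_spec z; rewrite /xhat sin_acos ?sqrrN //; lra. Qed.

Lemma angles_sin z x y : angles z x y -> sin x = Num.sg (sin x) * sinx z.
Proof.
move=> [cx _ _]; rewrite {1}[sin x]numEsg; congr (_ * _).
apply/eqP; rewrite -(@eqrXn2 _ 2) ?sinx_ge0 // real_normK ?num_real //.
by rewrite sin2cos2 cx sqrrN sinx_sqr.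
Qed.

Lemma twist_re_im (s : R) z :
  twist (- 2^-1) s z =
  (- 2^-1 + (cos (s * twist_angle z) * (Re z + 2^-1) - sin (s * twist_angle z) * Im z)) +i*
  (cos (s * twist_angle z) * Im z + sin (s * twist_angle z) * (Re z + 2^-1)).
Proof. by rewrite /twist -/(twist_angle z) center_sub; apply: plane_eq; rewrite //= add0r. Qed.

Lemma real_sub (c : R) z : c%:C - z = (c - Re z) +i* (- Im z).
Proof. by case: z => a b; apply: plane_eq; rewrite //= add0r. Qed.

Lemma cosx_one_twist (s : R) z : s = 1 \/ s = -1 -> cosx z = 1 ->
  twist_angle z = pi /\ cosx (twist (- 2^-1) s z) = 1.
Proof.
move=> s1 c1; have [_ h _] := cosx_spec z; have [z0 zI] := h c1.
have small : normc (z - (- 2^-1)%:C) <= 6 / 10.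
  by rewrite center_sub /= z0 expr0n addr0 sqrtr_sqr ler_norml; lra.
split; first exact: theta_inner.
by rewrite twist_half // real_sub; apply: cosx_eq1; rewrite /= ?z0; lra.
Qed.

Lemma cosx_opp_one_twist (s : R) z : cosx z = -1 ->
  twist_angle z = 0 /\ twist (- 2^-1) s z = z.
Proof.
move=> c1; have [_ _ h] := cosx_spec z; have [z0 zI] := h c1.
have large : 9 / 10 <= normc (z - (- 2^-1)%:C).
  by rewrite center_sub /= z0 expr0n addr0 sqrtr_sqr ger0_norm; lra.
by split; [exact: theta_outer|exact: twist_outer].
Qed.

Lemma angles_sin0 z x y : angles z x y -> sin x = 0 -> cosx z = 1 \/ cosx z = -1.
Proof.
move=> [cx _ _] s0; have := cos2Dsin2 x; rewrite s0 cx expr0n addr0 sqrrN => /eqP.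
by rewrite sqrf_eq1 => /orP[] /eqP; [left|right].
Qed.

(** If sin x = 0, then z lies either between the pegs -1 and 0, where x is pi modulo 2 pi and the
    twist is a half turn, or on the real axis from the peg 1 rightwards, where x is 0 modulo 2 pi
    and the twist does nothing. So the corrections in [angles_twist] vanish exactly where the sign
    of sin x may jump. *)
Lemma angles_twist_shift (s : R) z x y : s = 1 \/ s = -1 -> angles z x y ->
  sin x = 0 -> twist_angle z = xhat z /\ xhat (twist (- 2^-1) s z) = xhat z.
Proof.
move=> s1 zxy /(angles_sin0 zxy)[e|e].
  have [-> e'] := cosx_one_twist s1 e.
  by rewrite /xhat e e' acosN1.
have [-> ->] := cosx_opp_one_twist s e.
by rewrite /xhat e opprK acos1.
Qed.

Lemma twist_disc_bound z : normc (z - (- 2^-1)%:C) <= 6 / 10 ->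
  - (6 / 10) <= Re z + 2^-1 <= 6 / 10.
Proof.
move=> h; rewrite -ler_norml; apply: le_trans h.
by rewrite center_sub; exact: (normr_Re_le ((Re z + 2^-1) +i* Im z)).
Qed.

Lemma cosy_half_turn z : normc (z - (- 2^-1)%:C) <= 6 / 10 ->
  cosy ((2 * - 2^-1)%:C - z) = - cosy z.
Proof.
move=> h; have zI := twist_disc_bound h.
have e : (2 * - 2^-1)%:C - z - (- 2^-1)%:C = - (z - (- 2^-1)%:C).
  rewrite opprB addrAC -rmorphB; congr (_%:C - _); lra.
rewrite /cosy e normcN -mulNr; congr (_ / _).
rewrite real_sub /=.
by rewrite !min_l; lra.
Qed.

Lemma cosy_annulus z (r := normc (z - (- 2^-1)%:C)) : 6 / 10 <= r <= 9 / 10 ->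
  cosy z = (Re z + 2^-1) / r /\ Num.sg (Im z) * siny z = Im z / r.
Proof.
move=> rI; have [r0 r2] := normcP (z - (- 2^-1)%:C).
rewrite -/r center_sub /= in r0 r2.
have uI : Re z + 2^-1 <= 3 / 2 by nra.
have cE : cosy z = (Re z + 2^-1) / r by rewrite /cosy -/r max_l ?min_l //; lra.
split=> //; rewrite {2}[Im z]numEsg -mulrA; congr (_ * _).
have rn0 : r != 0 by rewrite gt_eqF //; lra.
apply/eqP; rewrite -(@eqrXn2 _ 2) ?siny_ge0 ?divr_ge0 //.
rewrite siny_sqr cE !exprMn real_normK ?num_real // exprVn.
have r2n0 : r ^+ 2 != 0 by rewrite sqrf_eq0.
by apply/eqP; apply: (mulIf r2n0); rewrite mulrBl !mulfVK // mul1r r2 addrC addKr.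
Qed.

(** In these coordinates a twist is only homotopic to the shear (x, y + s x). The exact formula
    moves x to the value over the image point, and in the shear term to the rotation angle, keeping
    both times the sign and period of x. The rotation angle is what y must gain, since y is a polar
    angle around the center of the twist. *)
Lemma angles_twist (s : R) z x y : s = 1 \/ s = -1 -> angles z x y ->
  angles (twist (- 2^-1) s z)
    (x + Num.sg (sin x) * (xhat (twist (- 2^-1) s z) - xhat z))
    (y + s * (x + Num.sg (sin x) * (twist_angle z - xhat z))).
Proof.
move=> s1 zxy; have [cx cy sxy] := zxy; set z' := twist _ s z.
have sx := angles_sin zxy; rewrite -sin_xhat in sx.
have cxh : cos x = cos (xhat z) by rewrite cos_xhat.
have deg := angles_twist_shift s1 zxy.
have sh0 : sin x = 0 -> sin (xhat z) = 0.
  move=> s0; apply/eqP; rewrite -sqrf_eq0 sin2cos2 -cxh -sin2cos2.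
  by rewrite s0 expr0n.
have [|cA sA] := @shift_angle x (xhat z) (xhat z') cxh sx.
  by move=> s0; have [_ ->] := deg s0; rewrite cxh sh0.
have [|cB sB] := @shift_angle x (xhat z) (twist_angle z) cxh sx.
  by move=> s0; have [-> _] := deg s0; rewrite cxh sh0.
move: cA sA cB sB; set A := x + _ * (xhat z' - _); set B := x + _ * (twist_angle z - _).
move=> cA sA cB sB.
have csB : cos (s * B) = cos (twist_angle z).
  by case: s1 => ->; rewrite ?mul1r ?mulN1r ?cosN.
have ssB : sin (s * B) = s * (Num.sg (sin x) * sin (twist_angle z)).
  by case: s1 => ->; rewrite ?mul1r ?mulN1r ?sinN sB.
suff [cy' sy'] : cos (y + s * B) = - cosy z' /\
    Num.sg (sin x) * sinx z' * sin (y + s * B) = sinxy z'.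
  by split=> //; rewrite ?cA ?cos_xhat ?sA ?sin_xhat.
rewrite cosD sinD csB ssB cy.
have [s0|s0] := eqVneq (sin x) 0.
  have [_ e'] := deg s0; have := sh0 s0; rewrite -e' sin_xhat => sz'0.
  rewrite s0 sgr0 !mul0r !mulr0 subr0 /sinxy sz'0 !(mul0r, mulr0) oppr0; split=> //.
  rewrite mulNr; congr (- _); have [e|e] := angles_sin0 zxy s0; last first.
    by rewrite /z'; have [-> ->] := cosx_opp_one_twist s e; rewrite cos0 mulr1.
  have [-> _] := cosx_one_twist s1 e; rewrite cospi mulrN1 /z'.
  have [_ h _] := cosx_spec z; have [z0 zI] := h e.
  have small : normc (z - (- 2^-1)%:C) <= 6 / 10.
    by rewrite center_sub /= z0 expr0n addr0 sqrtr_sqr ler_norml; lra.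
  by rewrite twist_half // cosy_half_turn.
have sg2 : Num.sg (sin x) ^+ 2 = 1 by rewrite sqr_sg s0.
have sx0 : sinx z != 0 by apply: contraNneq s0 => e; rewrite sx sin_xhat e mulr0.
(* The half plane containing z decides the sign of sin y relative to that of sin x. *)
have sy : Num.sg (sin x) * sin y = - (Num.sg (Im z) * siny z).
  apply: (mulfI sx0); rewrite -[RHS]/(sinx z * _) mulrN.
  have -> : sinx z * (Num.sg (Im z) * siny z) = - sinxy z by rewrite /sinxy opprK; ring.
  by rewrite opprK -sxy [in RHS]sx sin_xhat; ring.
pose r := normc (z - (- 2^-1)%:C).
(* On the inner disc the half turn negates [cosy]; outside nothing moves; on the annulus [cosy] and
   the signed [siny] are the coordinates of the unit vector along z + 1/2, which the twist
   rotates. *)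
have [r6|r6] := leP r (6 / 10).
  have z'E : z' = (2 * - 2^-1)%:C - z by rewrite /z' twist_half.
  have c' : cosy z' = - cosy z by rewrite z'E cosy_half_turn.
  have v' : Im z' = - Im z by rewrite z'E real_sub.
  rewrite /twist_angle theta_inner // cospi sinpi !mulr0 subr0 addr0 mulrN1 c'.
  split=> //; rewrite /sinxy v' sgrN /siny c' sqrrN -/(siny z) mulrN1.
  transitivity (- sinx z' * (Num.sg (sin x) * sin y)); first by ring.
  by rewrite sy; ring.
have [r9|r9] := leP (9 / 10) r.
  have -> : z' = z by rewrite /z' twist_outer.
  rewrite /twist_angle theta_outer // cos0 sin0 !mulr0 subr0 addr0 !mulr1.
  by split=> //; rewrite -sxy [in RHS]sx sin_xhat.
have [|cE sE] := @cosy_annulus z; first by rewrite -/r; lra.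
have r' : normc (z' - (- 2^-1)%:C) = r.
  by rewrite /z' /twist addrC addKr normcM normc_expi mul1r.
have [|cE' sE'] := @cosy_annulus z'; first by rewrite r'; lra.
rewrite r' in cE' sE'; rewrite -/r in cE sE.
have cs : cos (s * twist_angle z) = cos (twist_angle z).
  by case: s1 => ->; rewrite ?mul1r ?mulN1r ?cosN.
have ss : sin (s * twist_angle z) = s * sin (twist_angle z).
  by case: s1 => ->; rewrite ?mul1r ?mulN1r ?sinN.
have := twist_re_im s z; rewrite -/z' cs ss => z'E.
have rn0 : r != 0 by rewrite gt_eqF //; lra.
split.
  transitivity (- cosy z * cos (twist_angle z) -
    s * sin (twist_angle z) * (Num.sg (sin x) * sin y)); first by ring.
  by rewrite sy sE cE' cE z'E /=; field.
transitivity (sinx z' * (cos (twist_angle z) * (Num.sg (sin x) * sin y) -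
    Num.sg (sin x) ^+ 2 * s * sin (twist_angle z) * cosy z)); first by ring.
transitivity (- (sinx z' * (Num.sg (Im z') * siny z'))); last by rewrite /sinxy; ring.
by rewrite sg2 sy sE sE' cE z'E /=; field.
Qed.

Definition lifted (g : R -> plane R) (ab : int * int) :=
  [/\ continuous g, pegs (g 0), pegs (g 1) & exists x y : R -> R,
    [/\ continuous x, continuous y, forall t, angles (g t) (x t) (y t),
        x 1 - x 0 = ab.1%:~R * pi & y 1 - y 0 = ab.2%:~R * pi]].

Lemma peg_cosx z : pegs z -> cosx z ^+ 2 = 1.
Proof.
move=> /pegsP[c c3 ->]; case: c3 => [|[|]] ->.
- by rewrite cosx_eq1 //= ?expr1n //; lra.
- by rewrite cosx_eq1 //= ?expr1n //; lra.
- by rewrite cosx_eqN1 //= ?sqrrN ?expr1n //; lra.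
Qed.

Lemma peg_sin0 z x y : pegs z -> angles z x y -> sin x = 0.
Proof.
move=> /peg_cosx pz [cx _ _]; apply/eqP.
by rewrite -sqrf_eq0 sin2cos2 cx sqrrN pz subrr.
Qed.

Lemma continuous_twist (c s : R) : continuous (twist c s).
Proof. by have [g [_ _ ? _]] := twist_homeomorphism c s. Qed.

Lemma lifted_twist (e a b : int) (g : R -> plane R) : e = 1 \/ e = -1 ->
  lifted g (a, b) -> lifted (fun t => twist (- 2^-1) e%:~R (g t)) (a, b + e * a).
Proof.
move=> e1 [gc g0 g1 [x [y [xc yc gxy xa yb]]]].
have [s sE s1] : exists2 s : R, e%:~R = s & s = 1 \/ s = -1.
  by exists e%:~R => //; case: e1 => ->; [left|right].
rewrite sE.
have tc := cont_fun_comp (@continuous_twist (- 2^-1) s) gc.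
have tp p : pegs p -> pegs (twist (- 2^-1) s p).
  move=> pp; case: s1 => ->; first exact: (turn_pegs LeftTurn).
  exact: (turn_pegs LeftTurnInv).
split; [exact: tc|exact: tp|exact: tp|].
have xhc (f : R -> plane R) : continuous f -> continuous (fun t => xhat (f t)).
  move=> fc; apply: cont_acos => [|t]; first exact: cont_opp (cont_cosx fc).
  by have [? _ _] := cosx_spec (f t); lra.
have sinc : continuous (fun t => sin (x t)).
  exact: (cont_fun_comp (@continuous_sin R)).
have anglec : continuous (fun t => twist_angle (g t)).
  apply: (cont_fun_comp (@continuous_theta R)); apply: cont_normc.
  exact: (continuous_planeD gc (@cont_plane_cst R R _)).
have sh t : sin (x t) = 0 ->
    twist_angle (g t) - xhat (g t) = 0 /\ xhat (twist (- 2^-1) s (g t)) - xhat (g t) = 0.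
  by move=> /(angles_twist_shift s1 (gxy t))[-> ->]; rewrite subrr.
have c1 : continuous (fun t => Num.sg (sin (x t)) *
    (xhat (twist (- 2^-1) s (g t)) - xhat (g t))).
  apply: (cont_sg sinc) => [|t /sh[]//].
  by apply: cont_add; [exact: xhc|apply: cont_opp; exact: xhc].
have c2 : continuous (fun t => Num.sg (sin (x t)) * (twist_angle (g t) - xhat (g t))).
  apply: (cont_sg sinc) => [|t /sh[]//].
  by apply: cont_add; [exact: anglec|apply: cont_opp; exact: xhc].
exists (fun t => x t + Num.sg (sin (x t)) *
  (xhat (twist (- 2^-1) s (g t)) - xhat (g t))).
exists (fun t => y t + s * (x t + Num.sg (sin (x t)) *
  (twist_angle (g t) - xhat (g t)))).
(* Both ends are pegs, where sin x = 0: the corrections vanish there and the displacement undergoes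
   the exact shear. *)
have e0 := sh 0 (peg_sin0 g0 (gxy 0)); have e1' := sh 1 (peg_sin0 g1 (gxy 1)).
split.
- exact: cont_add.
- by apply: (cont_add yc); apply: (cont_mul (@cont_cst R R s)); exact: cont_add.
- by move=> t; exact: angles_twist.
- by rewrite (proj2 e0) (proj2 e1') !mulr0 !addr0.
- rewrite (proj1 e0) (proj1 e1') !mulr0 !addr0 opprD addrACA -mulrBr xa /= in yb *.
  by rewrite yb intrD intrM sE; ring.
Qed.

Lemma mirror_pegs z : pegs z -> pegs (mirror z).
Proof.
move=> /pegsP[x x3 ->]; apply/pegsP; exists (- x); last by [].
by case: x3 => [|[|]] ->; [right; right; lra|right; left; lra|left; lra].
Qed.

Lemma lifted_mirror (a b : int) (g : R -> plane R) :
  lifted g (a, b) -> lifted (fun t => mirror (g t)) (b, a).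
Proof.
move=> [gc g0 g1 [x [y [xc yc gxy xa yb]]]].
split; [exact: cont_mirror|exact: mirror_pegs|exact: mirror_pegs|].
by exists y, x; split=> // t; exact: angles_mirror.
Qed.

Lemma twist_mirror (c s : R) z : mirror (twist c s (mirror z)) = twist (- c) (- s) z.
Proof.
have e : normc (mirror z - c%:C) = normc (z - (- c)%:C).
  by case: z => a b /=; rewrite opprK -opprD sqrrN oppr0 !addr0.
rewrite /twist e mulNr /expi cosN sinN; case: z {e} => a b.
by apply: plane_eq => /=; ring.
Qed.

(** Reflection in the imaginary axis exchanges x and y and turns right turns into left turns. *)
Lemma lifted_turn s ab (g : R -> plane R) :
  lifted g ab -> lifted (fun t => turn_map s (g t)) (turn_rule s ab).
Proof.
case: ab => a b l; have right e : e = 1 \/ e = -1 ->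
    lifted (fun t => twist 2^-1 (- e%:~R) (g t)) (a + e * b, b).
  move=> e1; have := lifted_mirror (lifted_twist e1 (lifted_mirror l)).
  by rewrite (_ : (fun t => _) = fun t => twist 2^-1 (- e%:~R) (g t)) //;
    apply/funext => t; rewrite twist_mirror opprK.
case: s => /=.
- by have := lifted_twist (or_introl (erefl 1)) l; rewrite mul1r addrC.
- by have := right 1 (or_introl (erefl 1)); rewrite mul1r.
- by have := lifted_twist (or_intror (erefl (-1))) l; rewrite mulN1r.
- by have := right (-1) (or_intror (erefl (-1))); rewrite mulN1r opprK.
Qed.

(** Parametrized by a cosine so that (pi, t pi) is a lift. *)
Definition initial_path (t : R) : plane R := (- 2^-1 - cos (t * pi) / 2)%:C.

Lemma initial_pathP (t : R) : -1 <= - 2^-1 - cos (t * pi) / 2 <= 0.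
Proof. by have := cos_le1 (t * pi); have := cos_geN1 (t * pi); lra. Qed.

Lemma lifted_initial : lifted initial_path (0, 1).
Proof.
have tc : continuous (fun t : R => t * pi).
  exact: (cont_mul (@cont_id _) (@cont_cst R R pi)).
split.
- apply: continuous_plane; last exact: cont_cst.
  apply: (cont_add (@cont_cst R R (- 2^-1))); apply: cont_opp.
  apply: cont_mul; last exact: cont_cst.
  exact: (cont_fun_comp (@continuous_cos R)).
- by apply/pegsP; exists (-1); [left|rewrite /initial_path mul0r cos0; congr (_%:C); lra].
- by apply/pegsP; exists 0; [right; left|rewrite /initial_path mul1r cospi; congr (_%:C); lra].
exists (fun _ => pi), (fun t => t * pi); split; do ?by [exact: cont_cst|exact: tc].
- move=> t; have tI := initial_pathP t; split.
  + by rewrite cospi cosx_eq1.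
  + have [r [_ r0]] := cosyP (initial_path t).
    rewrite /= expr0n addr0 => r2.
    have r12 : r <= 2^-1 by nra.
    rewrite max_r // min_l; lra.
  + by rewrite sinpi mul0r /sinxy /= sgr0 mul0r oppr0.
- by rewrite subrr mul0r.
- by rewrite mul0r subr0.
Qed.

Lemma lifted_taffy t : lifted (fun u : R => pull_fun t (initial_path u)) (taffy_pair t).
Proof.
elim/last_ind: t => [|t s IH]; first exact: lifted_initial.
rewrite taffy_pair_rcons (_ : (fun u => _) =
  fun u => turn_map s (pull_fun t (initial_path u))); first exact: lifted_turn.
by apply/funext => u; exact: foldl_rcons.
Qed.

End Lifts.

(** * Lifts of homotopies *)

Section HomotopyLifting.
Variable R : realType.
Implicit Types z : plane R.

(** E2 is the square of the later [phase_root]; it equals n^2 when a, b, f are exactly p^2, q^2, p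
    q. *)
Lemma near_norm (p q a b f eta : R) (n := p ^+ 2 + q ^+ 2)
    (E2 := a * p ^+ 2 + b * q ^+ 2 + 2 * (f * (p * q))) :
  -1 <= p <= 1 -> -1 <= q <= 1 ->
  `|a - p ^+ 2| <= eta -> `|b - q ^+ 2| <= eta -> `|f - p * q| <= eta ->
  `|E2 - n ^+ 2| <= 4 * eta.
Proof.
move=> p1 q1 ha hb hf.
have -> : E2 - n ^+ 2 = (a - p ^+ 2) * p ^+ 2 + (b - q ^+ 2) * q ^+ 2
    + 2 * ((f - p * q) * (p * q)) by rewrite /E2 /n; ring.
have sq (r : R) : -1 <= r <= 1 -> `|r ^+ 2| <= 1.
  by move=> ?; rewrite ger0_norm ?sqr_ge0 //; nra.
have pq1 : `|p * q| <= 1 by rewrite normrM mulr_ile1 // ler_norml.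
have M (u v : R) : `|u| <= eta -> `|v| <= 1 -> `|u * v| <= eta.
  by move=> u1 v1; rewrite normrM -[leRHS]mulr1 ler_pM.
have := M _ _ ha (sq _ p1); have := M _ _ hb (sq _ q1); have := M _ _ hf pq1.
rewrite !ler_norml; move: (_ * (p * q)) (_ * q ^+ 2) (_ * p ^+ 2) => u v w.
by lra.
Qed.

(** As n >= mu, closeness of E^2 to n^2 gives E >= mu / 2 and |n - E| <= mu / 25, while the
    numerator is within mu / 50 of p n. The error is thus at most (mu / 50 + mu / 25) / E, below 1 /
    5. *)
Lemma near_root (p q a b f mu : R) (n := p ^+ 2 + q ^+ 2) (eta := mu ^+ 2 / 100)
    (E := Num.sqrt (a * p ^+ 2 + b * q ^+ 2 + 2 * (f * (p * q)))) :
  -1 <= p <= 1 -> -1 <= q <= 1 -> 0 < mu <= 1 -> mu <= n ->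
  `|a - p ^+ 2| <= eta -> `|b - q ^+ 2| <= eta -> `|f - p * q| <= eta ->
  [/\ 0 < E, E ^+ 2 = a * p ^+ 2 + b * q ^+ 2 + 2 * (f * (p * q)) &
      `|(a * p + f * q) / E - p| <= 1 / 5].
Proof.
move=> p1 q1 mu1 mun ha hb hf.
have := near_norm p1 q1 ha hb hf; rewrite -/n.
pose X := a * p ^+ 2 + b * q ^+ 2 + 2 * (f * (p * q)).
rewrite -/X => hE; have EX : E = Num.sqrt X by [].
have etaE : eta = mu ^+ 2 / 100 by [].
have nE : n = p ^+ 2 + q ^+ 2 by [].
have XE : X = a * p ^+ 2 + b * q ^+ 2 + 2 * (f * (p * q)) by [].
clearbody X n eta.
have eta0 : 0 < eta by rewrite etaE divr_gt0 // exprn_gt0 //; lra.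
have n2 : mu ^+ 2 <= n ^+ 2 by rewrite lerXn2r // ?nnegrE; lra.
have E2 : E ^+ 2 = X.
  rewrite EX sqr_sqrtr //; move: hE; rewrite ler_norml => /andP[h1 h2].
  have mu2 : 0 <= mu ^+ 2 := sqr_ge0 _.
  by lra.
have E0 : 0 <= E by rewrite EX sqrtr_ge0.
rewrite -E2 in hE; clearbody E.
have Emu : mu / 2 <= E.
  rewrite leNgt; apply/negP => h.
  by move: hE; rewrite ler_norml => /andP[]; nra.
have Egt0 : 0 < E by lra.
split; [exact: Egt0|by rewrite E2|].
have En : `|n - E| <= 4 * eta / mu.
  rewrite ler_pdivlMr; last by lra.
  apply: le_trans hE; rewrite subr_sqr distrC normrM ler_wpM2l //.
  by rewrite ger0_norm; lra.
have num : `|a * p + f * q - p * n| <= 2 * eta.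
  have -> : a * p + f * q - p * n = p * (a - p ^+ 2) + q * (f - p * q).
    by rewrite nE; ring.
  rewrite (le_trans (ler_normD _ _)) // mulr_natl mulr2n lerD // normrM.
    by rewrite -[leRHS]mul1r ler_pM // ler_norml.
  by rewrite -[leRHS]mul1r ler_pM // ler_norml.
have -> : (a * p + f * q) / E - p = ((a * p + f * q - p * n) + p * (n - E)) / E.
  by field; rewrite gt_eqF.
rewrite normrM [`|E^-1|]ger0_norm ?invr_ge0 // ler_pdivrMr //.
rewrite (le_trans (ler_normD _ _)) //.
have pn : `|p * (n - E)| <= 4 * eta / mu.
  by rewrite normrM -[leRHS]mul1r ler_pM // ler_norml.
have e1 : 4 * eta / mu = mu / 25 by rewrite etaE; field; lra.
have : 2 * eta <= mu / 50 by rewrite etaE; nra.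
by lra.
Qed.

Lemma atan_unit (N D : R) : N ^+ 2 + D ^+ 2 = 1 -> 3 / 4 < D ->
  [/\ cos (atan (N / D)) = D, sin (atan (N / D)) = N & `|atan (N / D)| < pi / 4].
Proof.
move=> ND D34; have D0 : D != 0 by rewrite gt_eqF //; lra.
have ND1 : `|N / D| < 1.
  rewrite normrM normfV [`|D|]gtr0_norm; last by lra.
  by rewrite ltr_pdivrMr ?mul1r; last lra; rewrite ltr_norml; nra.
have c : cos (atan (N / D)) = D.
  rewrite cos_atan (_ : 1 + _ = (D ^-1) ^+ 2).
    by rewrite sqrtr_sqr ger0_norm ?invr_ge0 ?invrK //; lra.
  rewrite expr_div_n -[1](@divff _ (D ^+ 2)) ?sqrf_eq0 // -mulrDl addrC ND.
  by rewrite mul1r exprVn.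
split=> //.
  have := atanK (N / D); rewrite /tan c => /(canRL (divfK D0)) ->.
  by rewrite divfK.
move: ND1; rewrite !ltr_norml -(@atan1 R) -atanN => /andP[h1 h2].
by rewrite !lt_atan.
Qed.

(** Weaker than [angles]: of the second angle only its sine q is kept, which is enough to select a
    branch of the square root p + i q. *)
Definition phase z (p q x : R) :=
  [/\ p ^+ 2 = 1 - cosx z ^+ 2, q ^+ 2 = 1 - cosy z ^+ 2, p * q = sinxy z,
      cos x = - cosx z & sin x = p].

Lemma angles_phase z x y : angles z x y -> phase z (sin x) (sin y) x.
Proof. by move=> [cx cy sxy]; split=> //; rewrite sin2cos2 ?cx ?cy sqrrN. Qed.

(* With S = p + i q, a square root of the complex number g attached to [z], and g'
   attached to [z'], the square root of g' close to S is the normalization of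
   |g'| S + g' conj S. *)
Definition phase_root z (p q : R) :=
  Num.sqrt ((1 - cosx z ^+ 2) * p ^+ 2 + (1 - cosy z ^+ 2) * q ^+ 2
            + 2 * (sinxy z * (p * q))).
Definition next_p z (p q : R) := ((1 - cosx z ^+ 2) * p + sinxy z * q) / phase_root z p q.
Definition next_q z (p q : R) := ((1 - cosy z ^+ 2) * q + sinxy z * p) / phase_root z p q.
(** By the addition formulas, with cos x = - [cosx z] and sin x = p, the argument of [atan] is the
    tangent of the increment of x. *)
Definition next_x z z' (p q x : R) :=
  x + atan ((cosx z' * p - cosx z * next_p z' p q) /
            (cosx z * cosx z' + p * next_p z' p q)).

Definition phase_close (mu : R) z z' :=
  [/\ `|cosx z' ^+ 2 - cosx z ^+ 2| <= mu ^+ 2 / 100,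
      `|cosy z' ^+ 2 - cosy z ^+ 2| <= mu ^+ 2 / 100,
      `|sinxy z' - sinxy z| <= mu ^+ 2 / 100 &
      `|cosx z' - cosx z| <= 1 / 100].

Lemma phase_step (mu : R) z z' p q x : phase z p q x ->
  0 < mu <= 1 -> mu <= p ^+ 2 + q ^+ 2 -> phase_close mu z z' ->
  [/\ 0 < phase_root z' p q, 0 < cosx z * cosx z' + p * next_p z' p q,
      phase z' (next_p z' p q) (next_q z' p q) (next_x z z' p q x) &
      `|next_x z z' p q x - x| < pi / 4].
Proof.
move=> [p2 q2 pq cx sx] mu1 mun [ca cb cf cc].
have [cxI _ _] := cosx_spec z.
have [E0 E2 pE] : [/\ 0 < phase_root z' p q, phase_root z' p q ^+ 2 =
    (1 - cosx z' ^+ 2) * p ^+ 2 + (1 - cosy z' ^+ 2) * q ^+ 2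
            + 2 * (sinxy z' * (p * q)) & `|next_p z' p q - p| <= 1 / 5].
  have D (u v : R) : (1 - u) - (1 - v) = - (u - v) by ring.
  apply: (near_root (mu := mu)) => //; try by apply/andP; split; nra.
  - by rewrite p2 D normrN.
  - by rewrite q2 D normrN.
  - by rewrite pq.
have f2 := sinxy_sqr z'.
have nE : phase_root z' p q != 0 by rewrite gt_eqF.
have p2' : next_p z' p q ^+ 2 = 1 - cosx z' ^+ 2.
  rewrite /next_p expr_div_n E2.
  apply: (canLR (mulfK _)); first by rewrite -E2 sqrf_eq0.
  transitivity ((1 - cosx z' ^+ 2) ^+ 2 * p ^+ 2 + sinxy z' ^+ 2 * q ^+ 2 +
    2 * (1 - cosx z' ^+ 2) * p * (sinxy z' * q)); first by ring.
  by rewrite f2; ring.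
have q2' : next_q z' p q ^+ 2 = 1 - cosy z' ^+ 2.
  rewrite /next_q expr_div_n E2.
  apply: (canLR (mulfK _)); first by rewrite -E2 sqrf_eq0.
  transitivity ((1 - cosy z' ^+ 2) ^+ 2 * q ^+ 2 + sinxy z' ^+ 2 * p ^+ 2 +
    2 * (1 - cosy z' ^+ 2) * q * (sinxy z' * p)); first by ring.
  by rewrite f2; ring.
have pq' : next_p z' p q * next_q z' p q = sinxy z'.
  rewrite /next_p /next_q mulrACA -invfM -expr2 E2.
  apply: (canLR (mulfK _)); first by rewrite -E2 sqrf_eq0.
  transitivity ((1 - cosx z' ^+ 2) * (1 - cosy z' ^+ 2) * (p * q) +
    sinxy z' * ((1 - cosx z' ^+ 2) * p ^+ 2 + (1 - cosy z' ^+ 2) * q ^+ 2) +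
    sinxy z' ^+ 2 * (p * q)); first by ring.
  by rewrite -f2; ring.
(* This is the cosine of the increment, at least 1 - 1 / 100 - 1 / 5; being above 3 / 4 it exceeds
   cos (pi / 4). *)
have D34 : 3 / 4 < cosx z * cosx z' + p * next_p z' p q.
  have pI : -1 <= p <= 1 by apply/andP; split; nra.
  move: cc pE; rewrite !ler_norml => cc pE.
  have -> : cosx z * cosx z' + p * next_p z' p q =
    (cosx z ^+ 2 + p ^+ 2) + cosx z * (cosx z' - cosx z) + p * (next_p z' p q - p) by ring.
  rewrite p2 [_ ^+ 2 + (1 - _)]addrC subrK.
  move: cc pE; move: (_ - cosx z) (_ - p) => u v uI vI.
  have : - (1 / 100) <= cosx z * u by nra.
  have : - (1 / 5) <= p * v by nra.
  by lra.
have ND : (cosx z' * p - cosx z * next_p z' p q) ^+ 2 +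
    (cosx z * cosx z' + p * next_p z' p q) ^+ 2 = 1.
  transitivity ((p ^+ 2 + cosx z ^+ 2) * (next_p z' p q ^+ 2 + cosx z' ^+ 2)); first by ring.
  by rewrite p2 p2' !subrK mulr1.
have [cA sA bA] := atan_unit ND D34.
split=> //; [by lra| |by rewrite /next_x addrC addKr].
split=> //; rewrite /next_x ?cosD ?sinD cA sA cx sx.
  transitivity (- (cosx z' * (p ^+ 2 + cosx z ^+ 2))); first by ring.
  by rewrite p2 subrK mulr1.
transitivity (next_p z' p q * (p ^+ 2 + cosx z ^+ 2)); first by ring.
by rewrite p2 subrK mulr1.
Qed.

End HomotopyLifting.

(** * Uniform estimates and one time step of a lift *)

Section Compactness.
Variable R : realType.

Lemma unit_square_compact : compact (`[0, 1]%classic `*` `[0, 1]%classic : set (R * R)).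
Proof. by apply: compact_setX; exact: segment_compact. Qed.

Lemma uniform_shift (f : R * R -> R) (eta : R) : continuous f -> 0 < eta ->
  \forall d \near (0 : R), forall t s, 0 <= t <= 1 -> 0 <= s <= 1 ->
    `|f (t + d, s) - f (t, s)| < eta.
Proof.
move=> fc eta0.
have /compact_near_coveringP nc := unit_square_compact.
have key : \forall d \near (0 : R), (`[0, 1]%classic `*` `[0, 1]%classic : set (R * R))
    `<=` [set x | `|f (x.1 + d, x.2) - f x| < eta].
  apply: (nc R (nbhs (0 : R)) (fun d x => `|f (x.1 + d, x.2) - f x| < eta)) => x _.
  have hc : continuous (fun y : (R * R) * R => f (y.1.1 + y.2, y.1.2) - f y.1).
    have c1 : continuous (fun y : (R * R) * R => y.1.1).
      exact: (cont_fun_comp (@cont_fst _ _) (@cont_fst _ _)).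
    have c2 : continuous (fun y : (R * R) * R => y.1.2).
      exact: (cont_fun_comp (@cont_snd _ _) (@cont_fst _ _)).
    apply: cont_add.
      exact: (cont_fun_comp fc (cont_pair (cont_add c1 (@cont_snd _ _)) c2)).
    by apply: cont_opp; exact: (cont_fun_comp fc (@cont_fst _ _)).
  have /cvgrPdist_lt/(_ _ eta0) := hc (x, 0).
  rewrite /= addr0 -surjective_pairing subrr => h.
  by apply: filterS h => y; rewrite sub0r normrN.
apply: filterS key => d kd t s tI sI.
by apply: (kd (t, s)); split; rewrite /= in_itv.
Qed.

Lemma small_angle (u : R) : `|u| < pi / 2 -> 1 / 2 < cos u ^+ 2 -> `|u| < pi / 4.
Proof.
move=> upi cu; have p0 := pi_gt0 R.
have : `|u| *+ 2 < pi / 2.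
  rewrite -ltr_cos; first by rewrite cos_pihalf cos_mulr2n cos_norm -mulr_natl; lra.
  - by rewrite in_itv /= mulrn_wge0 //= -mulr_natl; lra.
  - by rewrite in_itv /= ?divr_ge0 ?ltW //=; lra.
by rewrite -mulr_natl; lra.
Qed.

(** The difference of any two values of [x] has cosine 1, but if [x a] and [x b] differed, the
    intermediate value theorem would give two distinct values at distance at most pi. *)
Lemma cos_eqN1_const (x : R -> R) (a b : R) :
  continuous x -> (forall s, cos (x s) = -1) -> a <= b -> x a = x b.
Proof.
move=> xc xN1 ab; apply/eqP/negPn/negP => neq; have p0 := pi_gt0 R.
pose u := Num.min (x a) (x b); pose w := Num.max (x a) (x b).
have uw : u < w by move: neq; rewrite /u /w; case: (ltgtP (x a) (x b)).
pose v := Num.min w (u + pi).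
have vw : u < v <= w.
  by rewrite /v; case: (leP w (u + pi)) => h; rewrite ?uw ?lexx //; lra.
have vu : 0 < v - u <= pi.
  rewrite subr_gt0 (proj1 (andP vw)) /= /v.
  by case: (leP w (u + pi)) => h; lra.
have [|c _ xcv] := IVT ab (continuous_subspaceT xc) (v := v).
  by move: vw => /andP[h1 h2]; rewrite -/u -/w h2 (ltW h1).
have cu : cos u = -1 by rewrite /u; case: (leP (x a) (x b)) => _.
have cv : cos v = -1 by rewrite -xcv.
have su : sin u = 0 by apply: cos1sin0; rewrite cu normrN1.
have : cos (v - u) < cos 0.
  by rewrite ltr_cos ?in_itv /= ?lexx //; lra.
by rewrite cosB cu cv su mulr0 addr0 mulrNN mulr1 cos0 ltxx.
Qed.

Definition phase_path (g : R -> plane R) (p q x : R -> R) :=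
  [/\ continuous p, continuous q, continuous x &
      forall s, phase (g s) (p s) (q s) (x s)].

Definition weight (z : plane R) : R := (1 - cosx z ^+ 2) + (1 - cosy z ^+ 2).

Lemma path_step (mu : R) (g g' : R -> plane R) (p q x : R -> R) :
  continuous g -> continuous g' -> phase_path g p q x -> 0 < mu <= 1 ->
  (forall s, mu <= weight (g s)) -> (forall s, phase_close mu (g s) (g' s)) ->
  exists p' q' x', phase_path g' p' q' x' /\ forall s, `|x' s - x s| < pi / 4.
Proof.
move=> gc gc' [pc qc xc ph] mu1 wg cl.
have wpq s : mu <= p s ^+ 2 + q s ^+ 2.
  by have [-> -> _ _ _] := ph s; exact: wg.
have st s := phase_step (ph s) mu1 (wpq s) (cl s).
have cX := cont_cosx gc; have cX' := cont_cosx gc'; have cY' := cont_cosy gc'.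
have cF' := cont_sinxy gc'.
have c1 (f : R -> R) : continuous f -> continuous (fun s => 1 - f s ^+ 2).
  move=> fc; apply: (cont_add (@cont_cst R R 1)); apply: cont_opp; exact: cont_exp.
have rc : continuous (fun s => phase_root (g' s) (p s) (q s)).
  apply: (cont_fun_comp (@sqrt_continuous R)); apply: cont_add.
    by apply: cont_add; apply: cont_mul; do ?[exact: c1|exact: cont_exp].
  by apply: (cont_mul (@cont_cst R R 2)); apply: (cont_mul cF'); exact: cont_mul.
have rVc : continuous (fun s => (phase_root (g' s) (p s) (q s))^-1).
  by apply: (cont_inv rc) => s; have [r0 _ _ _] := st s; rewrite gt_eqF.
have npc : continuous (fun s => next_p (g' s) (p s) (q s)).
  apply: (cont_mul _ rVc); apply: cont_add; last exact: (cont_mul cF' qc).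
  exact: (cont_mul (c1 _ cX') pc).
have nqc : continuous (fun s => next_q (g' s) (p s) (q s)).
  apply: (cont_mul _ rVc); apply: cont_add; last exact: (cont_mul cF' pc).
  exact: (cont_mul (c1 _ cY') qc).
have nxc : continuous (fun s => next_x (g s) (g' s) (p s) (q s) (x s)).
  apply: (cont_add xc); apply: (cont_fun_comp (@continuous_atan R)).
  apply: cont_mul.
    by apply: (cont_add (cont_mul cX' pc)); apply: cont_opp; exact: (cont_mul cX npc).
  apply: cont_inv; first exact: (cont_add (cont_mul cX cX') (cont_mul pc npc)).
  by move=> s; have [_ r0 _ _] := st s; rewrite gt_eqF.
exists (fun s => next_p (g' s) (p s) (q s)), (fun s => next_q (g' s) (p s) (q s)),
  (fun s => next_x (g s) (g' s) (p s) (q s) (x s)).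
split; last by move=> s; have [] := st s.
by split; [exact: npc|exact: nqc|exact: nxc|move=> s; have [] := st s].
Qed.

(** The weight vanishes only where one of the real intervals [cosx] = 1 or -1 meets one of the
    intervals [cosy] = 1 or -1. Three of these intersections are single pegs; the fourth, with both
    values -1, is empty. *)
Lemma weight_gt0 (z : plane R) : ~ pegs z -> 0 < weight z.
Proof.
move=> np; have [cx x1 xN1] := cosx_spec z; have [cy y1 yN1] := cosy_spec z.
rewrite lt_def /weight addr_ge0 ?andbT; try by nra.
apply/eqP => w0; apply: np; apply/pegsP.
have cx2 : cosx z ^+ 2 = 1 by nra.
have cy2 : cosy z ^+ 2 = 1 by nra.
have [ex ey] : (cosx z = 1 \/ cosx z = -1) /\ (cosy z = 1 \/ cosy z = -1).
  move/eqP: cx2; move/eqP: cy2; rewrite !sqrf_eq1.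
  by move=> /orP[] /eqP ? /orP[] /eqP ?; split; auto.
have real : Im z = 0 -> z = (Re z)%:C by case: (z) => a b /= ->.
case: ex => /[dup] ex; [move=> /x1|move=> /xN1] => -[iz rx]; exists (Re z) => //;
  do ?exact: real;
  by case: ey => /[dup] ey; [move=> /y1|move=> /yN1] => -[_ ry];
   first [left; lra|right; left; lra|right; right; lra].
Qed.

End Compactness.

(** * Following a homotopy of arcs to its end, and the conclusion *)

Section Homotopy.
Variable R : realType.

Lemma near0_ball (P : R -> Prop) : (\forall d \near (0 : R), P d) ->
  exists2 e : R, 0 < e & forall d, `|d| < e -> P d.
Proof.
move=> /nbhs_ballP[e /= e0 eP]; exists e => // d de; apply: eP.
by rewrite /ball /= sub0r normrN.
Qed.

Lemma exists_margin (e1 e2 e3 : R) : 0 < e1 -> 0 < e2 -> 0 < e3 ->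
  exists eps : R, [/\ 0 < eps <= 1 - eps, eps < e1, eps < e2 & eps < e3].
Proof.
move=> e10 e20 e30; pose m := Num.min (1 / 4) (Num.min e1 (Num.min e2 e3)).
have m0 : 0 < m by rewrite !lt_min e10 e20 e30; lra.
have : m <= m by [].
rewrite {2}/m !le_min => /and4P[h1 h2 h3 h4]; clearbody m.
by exists (m / 2); split; lra.
Qed.

Lemma clip_bounds (eps s : R) (c := Num.max eps (Num.min (1 - eps) s)) :
  0 < eps <= 1 - eps -> eps <= c <= 1 - eps /\ 0 < c < 1.
Proof.
move=> /andP[eps0 eps1].
have cI : eps <= c <= 1 - eps by rewrite le_max lexx ge_max eps1 ge_min lexx.
by clearbody c; split=> //; lra.
Qed.

Lemma two_quarters (a b : R) : `|a| < pi / 4 -> `|b| < pi / 4 -> `|a + b| < pi / 2.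
Proof. by move=> h1 h2; apply: (le_lt_trans (ler_normD _ _)); lra. Qed.

(** On the last arc x is constant because [cosx] is 1, and its values near the two ends have stayed
    within pi/4 of [x 0] and [x 1]. *)
Lemma homotopy_endpoint (K : R * R -> plane R) (x y : R -> R) :
  continuous K -> continuous x -> continuous y ->
  (forall t, 0 <= t <= 1 -> pegs (K (t, 0)) /\ pegs (K (t, 1))) ->
  (forall t s, 0 <= t <= 1 -> 0 < s < 1 -> ~ pegs (K (t, s))) ->
  (forall s, angles (K (0, s)) (x s) (y s)) ->
  (forall s, 0 <= s <= 1 -> cosx (K (1, s)) = 1) ->
  `|x 1 - x 0| < pi.
Proof.
move=> Kc xc yc K01 Kint Kxy K1; have p0 := pi_gt0 R.
have cxc : continuous (fun u => cosx (K u)) by exact: cont_cosx.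
have cyc : continuous (fun u => cosy (K u)) by exact: cont_cosy.
have cfc : continuous (fun u => sinxy (K u)) by exact: cont_sinxy.
have cx2c : continuous (fun u => cosx (K u) ^+ 2) by exact: cont_exp.
have cy2c : continuous (fun u => cosy (K u) ^+ 2) by exact: cont_exp.
have half0 : (0 : R) < 1 / 2 by rewrite divr_gt0.
have pi40 : (0 : R) < pi / 4 by rewrite divr_gt0.
(* [uniform_shift] shifts the first coordinate; after the exchange the shift runs along the arc. *)
have swapc : continuous (fun u : R * R => cosx (K (u.2, u.1)) ^+ 2).
  exact: (cont_fun_comp cx2c (cont_pair (@cont_snd _ _) (@cont_fst _ _))).
have [e1 e10 He1] := near0_ball (uniform_shift swapc half0).
have xnear u : exists2 e : R, 0 < e & forall d, `|d| < e -> `|x (u + d) - x u| < pi / 4.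
  apply: near0_ball.
  have xuc : continuous (fun d => x (u + d)).
    exact: (cont_fun_comp xc (cont_add (@cont_cst R R u) (@cont_id _))).
  have /cvgrPdist_lt/(_ _ pi40) := xuc 0; rewrite addr0 => h.
  by apply: filterS h => d; rewrite distrC.
have [e2 e20 He2] := xnear 0; have [e3 e30 He3] := xnear 1.
have [eps [epsI epse1 epse2 epse3]] := exists_margin e10 e20 e30.
have [eps0 eps1] := andP epsI.
have epsn : `|eps| = eps by rewrite gtr0_norm.
have epsn' : `|- eps| = eps by rewrite normrN.
(* Clipping the parameter keeps the paths away from the pegs and still defined on the whole line. *)
pose cl (s : R) := Num.max eps (Num.min (1 - eps) s).
have clP s := clip_bounds s epsI.
have clI s : 0 <= cl s <= 1.
  by have [_ /andP[c0 c1]] := clP s; rewrite (ltW c0) (ltW c1).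
have cl_eps : cl eps = eps by rewrite /cl min_r ?maxxx.
have cl_1eps : cl (1 - eps) = 1 - eps by rewrite /cl minxx max_r.
have clc : continuous cl.
  apply: cont_max; first exact: cont_cst.
  by apply: cont_min; [exact: cont_cst|exact: cont_id].
have endcos t : 0 <= t <= 1 -> 1 / 2 < cosx (K (t, eps)) ^+ 2 /\
    1 / 2 < cosx (K (t, 1 - eps)) ^+ 2.
  move=> tI; have [t0 t1] := K01 t tI; split.
    have := He1 eps; rewrite epsn => /(_ epse1 0 t); rewrite lexx ler01 => /(_ isT tI) /=.
    by rewrite add0r (peg_cosx t0) ltr_norml; lra.
  have := He1 (- eps); rewrite epsn' => /(_ epse1 1 t); rewrite lexx ler01 => /(_ isT tI) /=.
  by rewrite (peg_cosx t1) ltr_norml; lra.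
have [mu mu1 Hmu] : exists2 mu : R, 0 < mu <= 1 & forall t s, 0 <= t <= 1 ->
    mu <= weight (K (t, cl s)).
  pose A := (`[0, 1]%classic `*` `[eps, 1 - eps]%classic : set (R * R)).
  have A0 : A !=set0 by exists (0, eps); split; rewrite /= in_itv /= lexx /=.
  have cA : compact A by apply: compact_setX; exact: segment_compact.
  have wc : continuous (fun u => weight (K u)).
    have c1 (f : R * R -> R) : continuous f -> continuous (fun u => 1 - f u).
      by move=> fc; apply: (cont_add (@cont_cst R (R * R)%type 1)); exact: cont_opp.
    by apply: cont_add; apply: c1.
  have [c] := compact_EVT_min A0 cA (continuous_subspaceT wc).
  rewrite inE => -[/=]; rewrite !in_itv /= => c1 /andP[c2 c3] cmin.
  have w0 : 0 < weight (K c).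
    apply: weight_gt0; rewrite [c]surjective_pairing; apply: Kint => //.
    by rewrite (lt_le_trans eps0 c2) (le_lt_trans c3) // ltrBlDr ltrDl.
  exists (Num.min 1 (weight (K c))); first by rewrite lt_min ltr01 w0 ge_min lexx.
  move=> t s tI; rewrite ge_min cmin ?orbT // inE; split; rewrite /= in_itv //=.
  by have [] := clP s.
have eta0 : 0 < mu ^+ 2 / 100 by rewrite divr_gt0 // exprn_gt0 //; case/andP: mu1.
have eta0' : (0 : R) < 1 / 100 by rewrite divr_gt0.
have [d1 d10 Hd1] := near0_ball (uniform_shift cx2c eta0).
have [d2 d20 Hd2] := near0_ball (uniform_shift cy2c eta0).
have [d3 d30 Hd3] := near0_ball (uniform_shift cfc eta0).
have [d4 d40 Hd4] := near0_ball (uniform_shift cxc eta0').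
have [N [N1 N2 N3 N4]] : exists N : nat,
  [/\ N.+1%:R^-1 < d1, N.+1%:R^-1 < d2, N.+1%:R^-1 < d3 & N.+1%:R^-1 < d4].
  have d0 : 0 < Num.min (Num.min d1 d2) (Num.min d3 d4).
    by rewrite !lt_min d10 d20 d30.
  have [N _ /(_ N (leqnn N))] := near_infty_natSinv_lt (PosNum d0).
  by rewrite /= !lt_min => /andP[/andP[? ?] /andP[? ?]]; exists N.
pose h : R := N.+1%:R^-1.
have h0 : 0 < h by rewrite invr_gt0.
have hn : `|h| = h by rewrite gtr0_norm.
pose g (k : nat) (s : R) := K (k%:R * h, cl s).
have gc k : continuous (g k).
  exact: (cont_fun_comp Kc (cont_pair (@cont_cst R R _) clc)).
have kI (k : nat) : (k <= N.+1)%N -> 0 <= k%:R * h <= 1.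
  move=> kN; apply/andP; split; first by rewrite mulr_ge0 // ltW.
  by rewrite /h ler_pdivrMr ?ltr0n // mul1r ler_nat.
have sin0x u : pegs (K (0, u)) -> sin (x u) = 0.
  by move=> pu; exact: (peg_sin0 pu (Kxy u)).
have [K00 K01'] : pegs (K (0, 0)) /\ pegs (K (0, 1)) by apply: K01; rewrite lexx ler01.
have lift k : (k <= N.+1)%N -> exists p q xk, [/\ phase_path (g k) p q xk,
    `|xk eps - x 0| < pi / 4 & `|xk (1 - eps) - x 1| < pi / 4].
  elim: k => [_|k IH kN].
    exists (fun s => sin (x (cl s))), (fun s => sin (y (cl s))), (fun s => x (cl s)).
    have xcl := cont_fun_comp xc clc.
    split; last 2 first.
    - by rewrite cl_eps -{1}[eps]add0r He2 // epsn.
    - by rewrite cl_1eps He3 // epsn'.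
    split; [exact: (cont_fun_comp (@continuous_sin R) xcl)| |exact: xcl|].
      exact: (cont_fun_comp (@continuous_sin R) (cont_fun_comp yc clc)).
    by move=> s; rewrite /g mul0r; apply: angles_phase.
  have [p [q [xk [ph x0 x1]]]] := IH (ltnW kN).
  have tI := kI k (ltnW kN); have tI' := kI k.+1 kN.
  have kS : k.+1%:R * h = k%:R * h + h by rewrite -natr1 mulrDl mul1r.
  have [|s|p' [q' [x' [ph' xx']]]] := path_step (gc k) (gc k.+1) ph mu1.
  - by move=> s; apply: Hmu.
  - rewrite /g kS; split; apply: ltW.
    + by apply: Hd1; rewrite ?hn.
    + by apply: Hd2; rewrite ?hn.
    + by apply: Hd3; rewrite ?hn.
    + by apply: Hd4; rewrite ?hn.
  exists p', q', x'.
  (* After a step the end is within pi/2 of [x v], a multiple of pi; cos^2 > 1/2 close to the peg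
     restores the bound pi/4. *)
  have tr (u v : R) : sin (x v) = 0 -> cl u = u ->
      1 / 2 < cosx (K (k.+1%:R * h, u)) ^+ 2 ->
      `|xk u - x v| < pi / 4 -> `|x' u - x v| < pi / 4.
    move=> sv clu cu xu; apply: small_angle.
      rewrite (_ : x' u - x v = (x' u - xk u) + (xk u - x v)); last by rewrite addrA subrK.
      by apply: two_quarters.
    have [_ _ _ ph'x] := ph'; have [_ _ _ cxu _] := ph'x u.
    rewrite cosB sv mulr0 addr0 exprMn cxu /g clu sqrrN.
    by have := cos2Dsin2 (x v); rewrite sv expr0n addr0 => ->; rewrite mulr1.
  have [c0 c1] := endcos _ tI'.
  by split=> //; apply: tr => //; exact: sin0x.
have [p [q [xN [[_ _ xNc ph] x0 x1]]]] := lift N.+1 (leqnn _).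
have NE : N.+1%:R * h = 1 by rewrite /h mulfV // pnatr_eq0.
have xN1 s : cos (xN s) = -1.
  by have [_ _ _ -> _] := ph s; rewrite /g NE K1.
have e := cos_eqN1_const xNc xN1 eps1.
rewrite (_ : x 1 - x 0 = (xN eps - x 0) - (xN (1 - eps) - x 1)); last by rewrite e; ring.
have x1' : `|- (xN (1 - eps) - x 1)| < pi / 4 by rewrite normrN.
apply: (lt_trans (two_quarters x0 x1')).
by rewrite gtr_pMr // invf_lt1 // ltr1n.
Qed.

Lemma initial_path_arc (s : R) : @initial_arc R (initial_path s).
Proof.
by exists (- 2^-1 - cos (s * pi) / 2) => //; rewrite /= in_itv /= initial_pathP.
Qed.

Lemma initial_path_pegs (s : R) : 0 < s < 1 -> ~ pegs (initial_path s).
Proof.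
move=> s01 /pegsP[x x3 [e]].
have p0 := pi_gt0 R.
have : cos pi < cos (s * pi) < cos 0.
  by rewrite !ltr_cos ?in_itv /= ?lexx ?ltW //; nra.
by rewrite cospi cos0; case: x3 e => [|[|]] ->; lra.
Qed.

Lemma taffy_arc_zeroP t :
  isotopic (taffy_arc t) (@initial_arc R) -> (taffy_pair t).1 = 0.
Proof.
move=> /isotopicP[H [[Hc Hh H0 Hp] H1]].
have [gc g0 g1 [x [y [xc yc gxy xa _]]]] := @lifted_taffy R t.
pose g (s : R) : plane R := pull_fun t (initial_path s).
(* Stages of the isotopy are injective and fix the pegs, so interior points of the arc never reach a
   peg. *)
have Hinj s z p : pegs p -> H (s, z) = p -> z = p.
  move=> pp; rewrite -[X in _ = X -> _](Hp s p pp).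
  by have [f [fK _ _ _]] := Hh s => /(congr1 f); rewrite (fK z) (fK p).
have : `|x 1 - x 0| < pi.
  apply: (@homotopy_endpoint (fun u => H (u.1, g u.2)) x y) => [|||s _|s u _ u01|s|s s01] /=.
  - exact: (cont_fun_comp Hc (cont_pair (@cont_fst _ _) (cont_fun_comp gc (@cont_snd _ _)))).
  - exact: xc.
  - exact: yc.
  - by rewrite !Hp.
  - move=> pH; apply: (initial_path_pegs u01); apply/(pull_fun_pegs t).
    by rewrite (_ : pull_fun t _ = H (s, g u)) //; apply: Hinj pH _.
  - by rewrite H0; exact: gxy.
  - have : @initial_arc R (H (1, g s)).
      rewrite -H1; exists (g s) => //; rewrite taffy_arcE.
      by exists (initial_path s) => //; exact: initial_path_arc.
    by move=> [c /=]; rewrite in_itv /= => cI <-; apply: cosx_eq1.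
rewrite xa normrM [`|pi|]ger0_norm ?pi_ge0 // gtr_pMl ?pi_gt0 //.
rewrite -intr_norm -[1]/(1%:~R) ltr_int; case: (taffy_pair t) => a b /=; lia.
Qed.

Lemma is_arc_taffy_arc t : is_arc (@taffy_arc R t).
Proof.
have [f [fK Kf fc _]] := @pull_fun_homeomorphism R t.
exists (fun s : R => pull_fun t (s - 1)%:C); split.
- apply: continuous_subspaceT; apply: (cont_fun_comp fc).
  apply: continuous_plane; last exact: cont_cst.
  exact: (cont_add (@cont_id _) (@cont_cst R R (-1))).
- by move=> a b _ _ /(can_inj fK) [] /addIr.
- rewrite taffy_arcE; apply/seteqP; split=> [_ [_ [x x01 <-] <-]|_ [s s01 <-]].
    exists (x + 1); last by rewrite addrK.
    by move: x01; rewrite /= !in_itv /=; lra.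
  exists (s - 1)%:C => //; exists (s - 1) => //.
  by move: s01; rewrite /= !in_itv /=; lra.
- split; apply/pull_fun_pegs/pegsP; eexists; try reflexivity.
    by left; lra.
  by right; left; lra.
- move=> s; rewrite in_itv /= => s01 /pull_fun_pegs/pegsP[x x3 [e]].
  by case: x3 e => [|[|]] ->; lra.
Qed.

(** Diagrams contain only arcs, so extracting an isotopy from equal diagrams uses that
    [taffy_arc t2] is itself an arc. *)
Lemma equivalentP t1 t2 :
  equivalent R t1 t2 <-> isotopic (@taffy_arc R t1) (taffy_arc t2).
Proof.
split=> [e|i].
  have : diagram t2 (@taffy_arc R t2).
    by split; [exact: is_arc_taffy_arc|exact: isotopic_refl].
  by rewrite -e => -[].
apply/seteqP; split=> B [aB iB]; split=> //.
  exact: isotopic_trans (isotopic_sym i) iB.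
exact: isotopic_trans i iB.
Qed.

End Homotopy.

Theorem theorem4 (R : realType) (t1 t2 : taffy_pull) :
  equivalent R t1 t2 <-> taffy_number t1 = taffy_number t2.
Proof.
have pairE : taffy_pair (t1 ++ pull_inv t2) = rules (pull_inv t2) (taffy_pair t1).
  exact: foldl_cat.
(* Undoing [t2] takes its vector to (0, 1), so by invariance of the determinant this coordinate is a
   d - b c for the vectors (a, b) and (c, d) of the two pulls. *)
have fracE : taffy_number t1 = taffy_number t2 <-> (taffy_pair (t1 ++ pull_inv t2)).1 = 0.
  have := rules_det (pull_inv t2) (taffy_pair t1) (taffy_pair t2).
  rewrite -pairE [rules _ (taffy_pair t2)]rulesK /= mulr1 mulr0 subr0 => ->.
  rewrite !taffy_numberE; have := taffy_pair_neq0 t1; have := taffy_pair_neq0 t2.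
  case: (taffy_pair t1) (taffy_pair t2) => a b [c d] n2 n1.
  by rewrite frac_eqP //=; lia.
rewrite equivalentP fracE.
have back (A : set (plane R)) : pull_fun t2 @` (pull_fun (pull_inv t2) @` A) = A.
  rewrite image_comp -[RHS]image_id; apply: eq_imagel => z _ /=.
  by rewrite -{1}[t2]pull_invK pull_funK.
split=> [i|z].
  apply: (@taffy_arc_zeroP R); rewrite taffy_arc_cat.
  have := isotopic_pull (pull_inv t2) i.
  rewrite [taffy_arc t2]taffy_arcE image_comp -[X in isotopic _ X -> _]/(_ @` _).
  rewrite (_ : _ \o pull_fun t2 = id) ?image_id //.
  by apply/funext => u; exact: pull_funK.
have := isotopic_pull t2 (taffy_arc_zero R z).
by rewrite taffy_arc_cat back -taffy_arcE.
Qed.
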